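(* Let $m_1,m_2,m_3\ge 1$ be integers, let $K$ be a field, and let $R = K[x_1, \ldots, x_{m_1}, y_1,\ldots,y_{m_2}, z_1,\ldots, z_{m_3}]$ with the standard grading. Let $G$ be the complete tripartite graph with parts $V_1=\{x_1,\ldots,x_{m_1}\}$, $V_2=\{y_1,\ldots,y_{m_2}\}$, $V_3=\{z_1,\ldots,z_{m_3}\}$, and let $J_G \subset R$ denote the cover ideal of $G$. Then for all $s \geq 2$, the minimal free resolution of $R/J_G^s$ is of the form \[ 0 \to R^{\binom{s}{2}} \longrightarrow R^{2\binom{s+1}{2}} \longrightarrow R^{\binom{s+2}{2}} \longrightarrow R \to 0. \] For integers $\ell_1,\ell_2,\ell_3$ set $\alpha = (s-\ell_3)m_1 +(s-\ell_2)m_2+ (s-\ell_1)m_3$. Then for all $s \geq 2$, \[ \operatorname{reg}(J_G^s) = \max \left\{ \begin{array}{ll} \alpha, & \text{ for } 0 \leq \ell_1, \ell_2,\ell_3 \leq s, \\ \alpha + m_3 -1, & \text{ for } 1 \leq \ell_1 \leq s,\; 0 \leq \ell_2,\ell_3 \leq s-1,\\ \alpha + 2m_3 -2, & \text{ for } 2 \leq \ell_1 \leq s,\; 0 \leq \ell_2,\ell_3 \leq s-2 \end{array} \right\}, \] the maximum being over all the listed numbers, where in each line $(\ell_1,\ell_2,\ell_3)$ ranges over the integer triples in the indicated range satisfying $\ell_1+\ell_2+\ell_3=s$.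
   Context: The complete tripartite graph with (disjoint, nonempty) parts $V_1,V_2,V_3$ has vertex set $V_1\sqcup V_2\sqcup V_3$ and edges all $\{a,b\}$ with $a\in V_i$, $b\in V_j$, $i\ne j$. A vertex cover of $G$ is a set $w$ of vertices meeting every edge. The cover ideal $J_G$ is the ideal generated by the squarefree monomials $\prod_{v\in w}v$ with $w$ a vertex cover of $G$ (vertices identified with variables); equivalently $J_G=\bigcap_{\{u,v\}\in E(G)}(u,v)$. For a finitely generated graded $R$-module $M$, $\operatorname{reg}(M)=\max\{j-i : \operatorname{Tor}_i^R(M,K)_j\neq 0\}$ is the Castelnuovo-Mumford regularity. *)

(* Defs.v *)
From HB Require Import structures.
From mathcomp Require Import all_boot all_order all_algebra.
From mathcomp.multinomials Require Import mpoly.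

Set Implicit Arguments.
Unset Strict Implicit.
Unset Printing Implicit Defensive.

Import GRing.Theory.

Local Open Scope ring_scope.

(* Simple graphs on 'I_n are given by their adjacency relation. *)

Definition is_vertex_cover n (e : rel 'I_n) (w : {set 'I_n}) : bool :=
  [forall u, forall v, e u v ==> (u \in w) || (v \in w)].

(* The vertices x_1..x_m1, y_1..y_m2, z_1..z_m3 are, in this order, the elements
   of 'I_(m1 + m2 + m3); [tripart v] is the index (0, 1 or 2) of the part of v. *)
Definition tripart (m1 m2 m3 : nat) (v : 'I_(m1 + m2 + m3)) : nat :=
  match split v with
  | inl u => match split u with inl _ => 0 | inr _ => 1 end
  | inr _ => 2
  end.

Definition complete_tripartite (m1 m2 m3 : nat) : rel 'I_(m1 + m2 + m3) :=
  fun u v => tripart u != tripart v.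
Arguments complete_tripartite m1 m2 m3 _ _ : clear implicits.

Section Ideals.
Variable R : comNzRingType.

Definition ideal_gen (S : R -> Prop) (f : R) : Prop :=
  exists (k : nat) (c g : 'I_k -> R),
    (forall i, S (g i)) /\ f = \sum_(i < k) c i * g i.

Definition ideal_pow (I : R -> Prop) (s : nat) : R -> Prop :=
  ideal_gen (fun f => exists g : 'I_s -> R,
    (forall i, I (g i)) /\ f = \prod_(i < s) g i).

Definition zero_ideal (f : R) : Prop := f = 0.
Definition unit_ideal (f : R) : Prop := True.

End Ideals.
Arguments zero_ideal {R} f.
Arguments unit_ideal {R} f.

Definition cover_ideal (K : fieldType) n (e : rel 'I_n) : {mpoly K[n]} -> Prop :=
  ideal_gen (fun f => exists w : {set 'I_n},
    is_vertex_cover e w /\ f = \prod_(v in w) 'X_v).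
Arguments cover_ideal K {n} e _.

Section Resolutions.
Variables (K : fieldType) (n : nat).
Local Notation R := {mpoly K[n]}.

(* Homogeneous of degree d, for d : int; 0 is homogeneous of every degree, and
   is the only homogeneous element of negative degree. *)
Definition zhomog (d : int) (f : R) : Prop :=
  f = 0 \/ exists2 k : nat, d = k%:Z & f \is k.-homog.

(* A sequence of graded free modules F_i = \bigoplus_(p < rk i) R(- gdeg i p) and
   maps dif i : F_(i+1) -> F_i. Elements of F_i are row vectors, on which
   matrices act by right multiplication. *)
Record free_seq := FreeSeq {
  rk : nat -> nat;
  gdeg : forall i, 'I_(rk i) -> int;
  dif : forall i, 'M[R]_(rk i.+1, rk i)
}.

(* The R-linear map given by M preserves degrees. *)
Definition graded_mx r c (dr : 'I_r -> int) (dc : 'I_c -> int) (M : 'M[R]_(r, c))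
    : Prop :=
  forall p q, zhomog (dr p - dc q) (M p q).

(* F is a graded free resolution of the graded R-module A / B, where B \subset A
   are homogeneous ideals of R. The augmentation F_0 -> A / B is the map
   v |-> v *m E modulo B. An ideal I is resolved as I / 0 and R / I as R / I. *)
Definition graded_free_resolution (A B : R -> Prop) (F : free_seq) : Prop :=
  exists E : 'M[R]_(rk F 0, 1),
    [/\ graded_mx (@gdeg F 0) (fun=> 0) E
          /\ (forall i, graded_mx (@gdeg F i.+1) (@gdeg F i) (dif F i)),
        forall f, A f <-> exists v : 'rV_(rk F 0), B (f - (v *m E) 0 0),
        forall v : 'rV_(rk F 0),
          B ((v *m E) 0 0) <-> exists w, v = w *m dif F 0
      & forall i (v : 'rV_(rk F i.+1)),
          v *m dif F i = 0 <-> exists w, v = w *m dif F i.+1].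

(* dif i maps F_(i+1) into (X_1, ..., X_n) F_i. *)
Definition minimal_seq (F : free_seq) : Prop :=
  forall i p q, (dif F i p q)@_0%MM = 0.

Definition minimal_graded_free_resolution (A B : R -> Prop) (F : free_seq) : Prop :=
  graded_free_resolution A B F /\ minimal_seq F.

(* The maps of the complex F \otimes_R K, where K = R / (X_1, ..., X_n) and
   F_i \otimes_R K = K^(rk i). *)
Definition difK (F : free_seq) i : 'M[K]_(rk F i.+1, rk F i) :=
  map_mx (mcoeff 0%MM) (dif F i).

(* v is in the degree j component of F_i \otimes_R K. *)
Definition in_degree (F : free_seq) i (j : int) (v : 'rV[K]_(rk F i)) : Prop :=
  forall p, v 0 p != 0 -> gdeg p = j.

Definition cycleK (F : free_seq) i : 'rV[K]_(rk F i) -> Prop :=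
  match i with
  | 0 => fun=> True
  | i'.+1 => fun v => v *m difK F i' = 0
  end.

Definition boundaryK (F : free_seq) i j (v : 'rV[K]_(rk F i)) : Prop :=
  exists2 w : 'rV[K]_(rk F i.+1), in_degree j w & v = w *m difK F i.

(* Tor_i^R(A / B, K)_j != 0, where Tor_i^R(A / B, K) is H_i(F \otimes_R K) for any
   graded free resolution F of A / B. *)
Definition Tor_neq0 (A B : R -> Prop) (i : nat) (j : int) : Prop :=
  exists F, graded_free_resolution A B F /\
  exists v : 'rV[K]_(rk F i), [/\ in_degree j v, cycleK v & ~ boundaryK j v].

(* r = reg (A / B) *)
Definition is_reg (A B : R -> Prop) (r : int) : Prop :=
  (exists (i : nat) (j : int), Tor_neq0 A B i j /\ j - i%:Z = r) /\
  (forall (i : nat) (j : int), Tor_neq0 A B i j -> j - i%:Z <= r).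

End Resolutions.

Definition tri_alpha (m1 m2 m3 s l1 l2 l3 : nat) : nat :=
  ((s - l3) * m1 + (s - l2) * m2 + (s - l1) * m3)%N.

(* Truncated subtraction is harmless since l1, l2, l3 <= s and m3 > 0; so is the
   value 0 of an empty \max, since all the numbers are natural and, for s >= 2,
   each of the three families is nonempty. *)
Definition tri_reg (m1 m2 m3 s : nat) : nat :=
  let alpha := tri_alpha m1 m2 m3 s in
  maxn (maxn
    (\max_(0 <= l1 < s.+1) \max_(0 <= l2 < s.+1)
       \max_(0 <= l3 < s.+1 | l1 + l2 + l3 == s) alpha l1 l2 l3)
    (\max_(1 <= l1 < s.+1) \max_(0 <= l2 < s)
       \max_(0 <= l3 < s | l1 + l2 + l3 == s) (alpha l1 l2 l3 + m3 - 1)))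
    (\max_(2 <= l1 < s.+1) \max_(0 <= l2 < s.-1)
       \max_(0 <= l3 < s.-1 | l1 + l2 + l3 == s) (alpha l1 l2 l3 + 2 * m3 - 2)).

(* Main.v *)
Require Import Defs.
From HB Require Import structures.
From mathcomp Require Import all_boot all_order all_algebra.
From mathcomp.multinomials Require Import mpoly.
From mathcomp Require Import zify ring.
Local Open Scope ring_scope.

(* Let X, Y, Z be the products of the variables of the three parts. The minimal
   vertex covers are the unions of two parts, so J = (XY, XZ, YZ), and J^s is
   generated by the (XY)^a (XZ)^b (YZ)^(s-a-b). With T1, T2, T3 standing for XY,
   XZ, YZ, the degree s strand of the Koszul complex of Z T1 - X T3 and
   Y T2 - X T3 over R[T1, T2, T3] is a graded free resolution of J^s, because
   X, Y, Z is a regular sequence in every order; it is minimal because X, Y, Z have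
   positive degree. Graded lifting compares any other graded free resolution with
   it, which determines the ranks of minimal resolutions and the degrees of Tor. *)

(** The generator (XY)^a (XZ)^b (YZ)^c, with a + b + c = s, has degree alpha at (l1, l2, l3) = (a,
    b, c). Both Koszul relations contain the term X T3, so their multiples by one monomial have the
    same degree; read off the term Z T1, it is alpha with l1 raised by one, plus a surplus m3. A
    second syzygy raises l1 twice and adds 2 m3, and the -1 and -2 of the formula are homological
    degrees. Taking T1 as reference is what makes the formula look asymmetric in the parts.
    Exactness is proved by elimination: forms in T1, T2, T3 are coefficient functions of two
    exponents, and kernels are computed diagonal by diagonal for [D0] and lexicographically for the
    augmentation. [Tor_neq0] may be witnessed by a resolution that is not minimal, so bounding its
    degrees takes a chain homotopy. The comparison is made for A / B with B homogeneous, to serve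
    both J^s = J^s / 0 and R / J^s. *)

Set Implicit Arguments.
Unset Strict Implicit.
Unset Printing Implicit Defensive.

Import Order.TTheory GRing.Theory Num.Theory.

(** * Homogeneous components over the integers *)

Section HomogeneousComponents.
Variables (K : fieldType) (n : nat).
Local Notation R := {mpoly K[n]}.

Definition zcomp (d : int) (f : R) : R :=
  if d is Posz k then pihomog mdeg k f else 0.

Lemma zcomp_homog d f : zhomog d (zcomp d f).
Proof.
case: d => k /=; last by left.
by right; exists k => //; exact: pihomogP.
Qed.

Lemma zcomp_id d f : zhomog d f -> zcomp d f = f.
Proof.
case=> [->|[k -> hf]] /=; last exact: pihomog_dE.
by case: d => //= k; rewrite pihomog0.
Qed.

Lemma zcomp_sum d (I : finType) (F : I -> R) :
  zcomp d (\sum_i F i) = \sum_i zcomp d (F i).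
Proof.
by case: d => k /=; [rewrite raddf_sum | rewrite big1].
Qed.

Lemma zcompM d e f g : zhomog e g -> zcomp d (f * g) = zcomp (d - e) f * g.
Proof.
case=> [->|[k -> hg]]; first by rewrite !mulr0; case: d => //= k; rewrite pihomog0.
have hfg i : pihomog mdeg i f * g \is (i + k).-homog.
  by apply: dhomogM => //; exact: pihomogP.
(* N bounds [msize f], so that the decomposition of f is complete, and exceeds |d|, so that the
   index d - k, when nonnegative, occurs in the sum. *)
have [N [hN hd]] : exists N, (msize f <= N)%N /\ (`|d| < N)%N.
  by exists (maxn (msize f) (`|d|.+1)); rewrite !leq_max !leqnn orbT.
rewrite {1}(pihomog_partitionE hN) mulr_suml.
have -> : zcomp d (\sum_(i < N) pihomog mdeg i f * g) =
          \sum_(i < N | d == (i + k)%N%:Z) pihomog mdeg i f * g.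
  rewrite [RHS]big_mkcond zcomp_sum /=; apply: eq_bigr => i _.
  case: eqP => [->|]; first by rewrite /= pihomog_dE.
  case: d {hd} => //= d /eqP; rewrite eqz_nat => ne.
  by apply: (pihomog_ne0 _ (hfg i)); rewrite eq_sym.
case E: (d - k%:Z) => [j|j] /=; last first.
  by rewrite mul0r big1 // => i /eqP hi; lia.
have hj : (j < N)%N by lia.
rewrite (big_pred1 (Ordinal hj)) // => i /=.
by rewrite -val_eqE /=; lia.
Qed.

Lemma zhomog_mcoeff0 d (f : R) : zhomog d f -> f@_0%MM != 0 -> d = 0.
Proof.
case=> [->|[k -> hf]]; first by rewrite mcoeff0 eqxx.
apply: contraNeq => hk; apply/eqP; apply: (dhomog_nemf_coeff hf).
by rewrite mf0 eq_sym.
Qed.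

(** Any lift can be made graded: keep in entry (p, q) only the component of degree dr p - dk q. As N
    and D are homogeneous, the discarded components contribute nothing to N. *)
Lemma graded_mx_lift r k c (dr : 'I_r -> int) (dk : 'I_k -> int)
    (dc : 'I_c -> int) (N : 'M[R]_(r, c)) (D : 'M[R]_(k, c)) :
    graded_mx dr dc N -> graded_mx dk dc D ->
    (forall p, exists v : 'rV_k, row p N = v *m D) ->
  exists2 P : 'M_(r, k), graded_mx dr dk P & N = P *m D.
Proof.
move=> hN hD /fin_all_exists [v hv].
exists (\matrix_(p, q) zcomp (dr p - dk q) (v p 0 q)).
  by move=> p q; rewrite mxE; exact: zcomp_homog.
apply/matrixP=> p q; rewrite -(zcomp_id (hN p q)).
have := congr1 (fun M : 'M_(_, _) => M 0 q) (hv p); rewrite mxE => ->.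
rewrite !mxE zcomp_sum; apply: eq_bigr => t _.
by rewrite mxE (zcompM _ _ (hD t q)); congr (zcomp _ _ * _); lia.
Qed.

Lemma graded_mxM r k c (dr : 'I_r -> int) (dk : 'I_k -> int)
    (dc : 'I_c -> int) (N : 'M[R]_(r, k)) (D : 'M[R]_(k, c)) :
  graded_mx dr dk N -> graded_mx dk dc D -> graded_mx dr dc (N *m D).
Proof.
move=> hN hD p q; rewrite mxE.
rewrite (eq_bigr (fun t => zcomp (dr p - dc q) (N p t * D t q))).
  by rewrite -zcomp_sum; exact: zcomp_homog.
move=> t _; rewrite (zcompM _ _ (hD t q)) zcomp_id //.
by have := hN p t; congr (zhomog _ _); lia.
Qed.

End HomogeneousComponents.

(** * Comparison of graded free resolutions *)

Section Comparison.
Variables (K : fieldType) (n : nat).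
Local Notation R := {mpoly K[n]}.
Implicit Types (A B : R -> Prop) (F G : free_seq K n).

Definition homog_ideal B : Prop :=
  [/\ B 0, forall a f g, B f -> B g -> B (f + a * g)
    & forall d f, B f -> B (zcomp d f)].

Lemma zero_ideal_homog : homog_ideal (@zero_ideal R).
Proof.
split=> // [a f g -> ->|d f ->]; first by rewrite /zero_ideal mulr0 addr0.
by apply: zcomp_id; left.
Qed.

Definition resolves A B F (E : 'M[R]_(rk F 0, 1)) : Prop :=
  [/\ graded_mx (@gdeg _ _ F 0) (fun=> 0) E
        /\ (forall i, graded_mx (@gdeg _ _ F i.+1) (@gdeg _ _ F i) (dif F i)),
      forall f, A f <-> exists v : 'rV_(rk F 0), B (f - (v *m E) 0 0),
      forall v : 'rV_(rk F 0),
        B ((v *m E) 0 0) <-> exists w, v = w *m dif F 0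
    & forall i (v : 'rV_(rk F i.+1)),
        v *m dif F i = 0 <-> exists w, v = w *m dif F i.+1].

(** In degree 0 a cycle is a vector that the augmentation sends into B; with this convention
    exactness takes one form, [cycP], in all degrees. *)
Definition cyc B F (E : 'M[R]_(rk F 0, 1)) i : 'rV[R]_(rk F i) -> Prop :=
  if i is i'.+1 then fun v => v *m dif F i' = 0 else fun v => B ((v *m E) 0 0).

Lemma cycP A B F E i (v : 'rV_(rk F i)) :
  resolves A B E -> cyc B E v <-> exists w, v = w *m dif F i.
Proof. by case: i v => [|i] v [_ _ h0 h]; [exact: h0 | exact: h]. Qed.

Lemma dif_dif A B F E i : @resolves A B F E -> dif F i.+1 *m dif F i = 0.
Proof.
case=> _ _ _ h; apply/row_matrixP => p; rewrite row0 row_mul.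
by apply/h; exists (delta_mx 0 p); rewrite -rowE.
Qed.

Lemma mx_factor r k c (N : 'M[R]_(r, c)) (D : 'M[R]_(k, c)) :
  (forall p, exists v : 'rV_k, row p N = v *m D) -> exists P, N = P *m D.
Proof.
move=> /fin_all_exists [v hv]; exists (\matrix_p v p).
by apply/row_matrixP => p; rewrite row_mul rowK hv.
Qed.

(* The part of a null-homotopy at F_i that factors through F_(i-1). *)
Definition homotopy_head F i : 'M[R]_(rk F i) -> Prop :=
  if i is i'.+1 then fun T => exists h, T = dif F i' *m h else fun T => T = 0.

Variables (A B : R -> Prop).
Hypothesis hB : homog_ideal B.

(** At the augmentation, lifting is possible only modulo B. Homogeneity of B is what keeps the error
    in B when the lift is replaced by its homogeneous components. *)
Lemma chain_map0 F G E E' : @resolves A B F E -> @resolves A B G E' ->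
  exists phi, [/\ graded_mx (@gdeg _ _ F 0) (@gdeg _ _ G 0) phi,
    forall v : 'rV_(rk F 0), cyc B E v -> cyc B E' (v *m phi)
  & forall v : 'rV_(rk F 0), B ((v *m (E - phi *m E')) 0 0)].
Proof.
case: hB => B0 Blin Bhom [[gE _] hF _ _] [[gE' _] hG _ _].
have Bsum (I : finType) (c f : I -> R) : (forall i, B (f i)) -> B (\sum_i c i * f i).
  move=> hf; apply: (big_ind B) => // [x y hx hy|i _].
    by have := Blin 1 _ _ hx hy; rewrite mul1r.
  by have := Blin (c i) _ _ B0 (hf i); rewrite add0r.
have hE p : exists v : 'rV_(rk G 0), B (E p 0 - (v *m E') 0 0).
  apply/hG/hF; exists (delta_mx 0 p); rewrite -rowE mxE subrr; exact: B0.
have [v hv] := fin_all_exists hE.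
pose phi := \matrix_(p, q) zcomp (gdeg p - gdeg q) (v p 0 q).
have Bv (u : 'rV_(rk F 0)) : B ((u *m (E - phi *m E')) 0 0).
  rewrite mxE; apply: Bsum => p; have := Bhom (gdeg p) _ (hv p).
  congr B; rewrite !mxE -sumrN.
  have -> (d : int) f g : zcomp d (f + g) = zcomp d f + zcomp d g.
    by case: d => k /=; rewrite ?raddfD ?addr0.
  rewrite zcomp_id; last by have := gE p 0; rewrite subr0.
  congr (_ + _); rewrite zcomp_sum -sumrN; apply: eq_bigr => t _.
  rewrite mxE -mulNr (zcompM _ _ (gE' t 0)) subr0 -mulNr; congr (_ * _).
  by case: (_ - _) => k /=; rewrite ?raddfN ?oppr0.
exists phi; split=> // [p q|u hu].
  by rewrite mxE; exact: zcomp_homog.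
have -> : cyc B E' (u *m phi) = B ((u *m E) 0 0 + (-1) * (u *m (E - phi *m E')) 0 0).
  by rewrite /cyc mulmxBr mulmxA !mxE mulN1r opprB addrC subrK.
exact: Blin.
Qed.

Lemma chain_mapS F G E E' i phi :
    @resolves A B F E -> @resolves A B G E' ->
    graded_mx (@gdeg _ _ F i) (@gdeg _ _ G i) phi ->
    (forall v : 'rV_(rk F i), cyc B E v -> cyc B E' (v *m phi)) ->
  exists phi', [/\ graded_mx (@gdeg _ _ F i.+1) (@gdeg _ _ G i.+1) phi',
    forall v : 'rV_(rk F i.+1), cyc B E v -> cyc B E' (v *m phi')
  & dif F i *m phi = phi' *m dif G i].
Proof.
move=> rF rG gphi hphi.
have [[[_ gF] _ _ _] [[_ gG] _ _ _]] := (rF, rG).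
have [p|phi' gphi' e] := graded_mx_lift (graded_mxM (gF i) gphi) (gG i).
  rewrite row_mul; apply/(cycP _ rG)/hphi/(cycP _ rF).
  by exists (delta_mx 0 p); rewrite -rowE.
exists phi'; split=> // v /= hv.
by rewrite -mulmxA -e mulmxA hv mul0mx.
Qed.

(** The induction carries one half of a homotopy between the identity of F and F -> G -> F. The last
    conclusion says that 1 - phi psi - theta takes values in cycles; exactness turns it into h
    followed by [dif F i], and [dif F i] followed by h is the theta of the next degree. *)
Lemma comparison F G E E' i : @resolves A B F E -> @resolves A B G E' ->
  exists phi psi theta,
    [/\ graded_mx (@gdeg _ _ F i) (@gdeg _ _ G i) phi,
        graded_mx (@gdeg _ _ G i) (@gdeg _ _ F i) psi,
        homotopy_head theta,
        (forall v : 'rV_(rk F i), cyc B E v -> cyc B E' (v *m phi))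
        /\ (forall v : 'rV_(rk G i), cyc B E' v -> cyc B E (v *m psi))
      & forall v : 'rV_(rk F i), cyc B E (v *m (1%:M - phi *m psi - theta))].
Proof.
move=> rF rG; elim: i => [|i [phi [psi [theta [gphi gpsi htheta [cphi cpsi] hom]]]]].
  have [phi [gphi cphi ephi]] := chain_map0 rF rG.
  have [psi [gpsi cpsi epsi]] := chain_map0 rG rF.
  exists phi, psi, 0; split=> // v; rewrite subr0 /=.
  have [_ Blin _] := hB; have := Blin 1 _ _ (ephi v) (epsi (v *m phi)).
  rewrite mul1r.
  have -> : v *m (1%:M - phi *m psi) *m E =
      v *m (E - phi *m E') + v *m phi *m (E' - psi *m E).
    by rewrite mulmxBr mulmxBl mulmx1 !mulmxBr !mulmxA addrA subrK.
  by move=> hv; rewrite mxE.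
have [phi' [gphi' cphi' ephi']] := chain_mapS rF rG gphi cphi.
have [psi' [gpsi' cpsi' epsi']] := chain_mapS rG rF gpsi cpsi.
have [p|h eh] := @mx_factor _ _ _ (1%:M - phi *m psi - theta) (dif F i).
  by rewrite rowE; apply/(cycP _ rF)/hom.
exists phi', psi', (dif F i *m h); split=> // [|v /=]; first by exists h.
(* For i > 0, theta starts with the preceding differential, so two consecutive differentials
   meet. *)
have dtheta : dif F i *m theta = 0.
  case: (i) theta {hom eh} htheta => [|j] theta /=; first by move=> ->; rewrite mulmx0.
  by case=> h' ->; rewrite mulmxA (dif_dif _ rF) mul0mx.
rewrite -mulmxA !mulmxBl -[phi' *m _ *m _]mulmxA -epsi' mulmxA.
rewrite -ephi' -[dif F i *m h *m _]mulmxA -eh.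
rewrite [dif F i *m (_ - theta)]mulmxBr dtheta subr0 [dif F i *m (_ - _)]mulmxBr.
by rewrite mul1mx mulmx1 [dif F i *m (_ *m _)]mulmxA subrr mulmx0.
Qed.

(** Taking constant terms tensors the homotopy with K. A nonzero constant in a graded matrix forces
    equal degrees, and theta, which factors through the preceding differential, dies on cycles and
    dies altogether when F is minimal. *)
Lemma comparisonK F G i :
    graded_free_resolution A B F -> graded_free_resolution A B G ->
  exists (phi : 'M[K]_(rk F i, rk G i)) psi theta h,
    [/\ forall p q, phi p q != 0 -> @gdeg _ _ F i p = @gdeg _ _ G i q,
        (minimal_seq F -> theta = 0) /\
        (forall v : 'rV_(rk F i), cycleK v -> v *m theta = 0)
      & 1%:M = phi *m psi + theta + h *m difK F i].
Proof.
move=> [E rF] [E' rG].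
have [phi [psi [theta [gphi gpsi htheta [cphi cpsi] hom]]]] := comparison i rF rG.
have [p|h eh] := @mx_factor _ _ _ (1%:M - phi *m psi - theta) (dif F i).
  by rewrite rowE; apply/(cycP _ rF)/hom.
pose ev r c (M : 'M[R]_(r, c)) := map_mx (mcoeff 0%MM) M.
exists (ev _ _ phi), (ev _ _ psi), (ev _ _ theta), (ev _ _ h); split.
- move=> p q; rewrite mxE => /(zhomog_mcoeff0 (gphi p q)) /eqP.
  by rewrite subr_eq0 => /eqP.
- case: (i) theta {hom eh} htheta => [|j] theta /=.
    by move=> ->; rewrite /ev map_mx0; split=> // v _; rewrite mulmx0.
  case=> h' ->; rewrite /ev map_mxM; split=> [mF|v].
    rewrite (_ : map_mx _ (dif F j) = 0) ?mul0mx //.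
    by apply/matrixP=> p q; rewrite !mxE; exact: mF.
  by rewrite mulmxA => ->; rewrite mul0mx.
have := congr1 (ev _ _) eh; rewrite /ev !map_mxB map_mx1 !map_mxM /difK => <-.
by rewrite [RHS]addrC [_ *m _ + _]addrC addrA !subrK.
Qed.

End Comparison.

(** * Ranks of minimal resolutions and degrees of Tor *)

Section Invariance.
Variables (K : fieldType) (n : nat).
Local Notation R := {mpoly K[n]}.
Variables (A B : R -> Prop).
Hypothesis hB : homog_ideal B.

(** Minimality of F kills theta and [difK F i], so the identity of K^(rk F i) factors through K^(rk
    G i). *)
Lemma minimal_rk_le F G i :
    minimal_graded_free_resolution A B F -> graded_free_resolution A B G ->
  (rk F i <= rk G i)%N.
Proof.
move=> [rF mF] rG.
have [phi [psi [theta [h [_ [/(_ mF) -> _]]]]]] := comparisonK hB i rF rG.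
rewrite addr0 (_ : difK F i = 0) ?mulmx0 ?addr0; last first.
  by apply/matrixP=> p q; rewrite !mxE; exact: mF.
move=> e; rewrite -(mxrank1 K (rk F i)) e.
exact: leq_trans (mxrankM_maxl _ _) (rank_leq_col _).
Qed.

Lemma minimal_rk F G i :
    minimal_graded_free_resolution A B F -> minimal_graded_free_resolution A B G ->
  rk F i = rk G i.
Proof.
move=> hF hG; apply/eqP; rewrite eqn_leq.
by rewrite !minimal_rk_le //; [case: hF | case: hG].
Qed.

(** Either the class survives in G, where a nonzero coordinate has degree j, or v *m phi = 0 and the
    homotopy exhibits v as a boundary. *)
Lemma Tor_neq0_gdeg G i j : graded_free_resolution A B G ->
  Tor_neq0 A B i j -> exists p, @gdeg _ _ G i p = j.
Proof.
move=> rG [F [rF [v [vj vc vb]]]].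
have [phi [psi [theta [h [gphi [_ /(_ v vc) vtheta] e]]]]] := comparisonK hB i rF rG.
have [vphi|/rV0Pn[q]] := eqVneq (v *m phi) 0; last first.
  rewrite mxE; have [/existsP[p]|] := boolP [exists p, v 0 p * phi p q != 0].
    rewrite mulf_eq0 negb_or => /andP[/vj <- /gphi ->] _; by exists q.
  by rewrite negb_exists => /forallP h0; rewrite big1 ?eqxx // => p _;
    apply/eqP; have := h0 p; rewrite negbK.
case: vb; have {}e : v = v *m h *m difK F i.
  by rewrite -{1}(mulmx1 v) e !mulmxDr vtheta mulmxA vphi mul0mx !add0r mulmxA.
have [E [[_ gF] _ _ _]] := rF.
have gd p q : difK F i p q != 0 -> gdeg p = gdeg q.
  rewrite mxE => /(zhomog_mcoeff0 (gF i p q)) /eqP.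
  by rewrite subr_eq0 => /eqP.
(* [boundaryK] asks for a preimage of degree j. Since [difK] joins only equal degrees, the
   coordinates of v *m h in other degrees can be erased. *)
exists (\row_p if gdeg p == j then (v *m h) 0 p else 0) => [p|].
  by rewrite mxE; have [|_] := eqVneq (gdeg p) j; rewrite ?eqxx.
apply/rowP=> q; have -> : v 0 q = if gdeg q == j then (v *m h *m difK F i) 0 q else 0.
  rewrite -e; case: eqP => // hq; apply/eqP; apply: contra_notT hq; exact: vj.
rewrite !mxE; case: eqP => hq; last first.
  rewrite big1 // => p _; rewrite mxE; case: eqP => [hp|]; last by rewrite mul0r.
  suff -> : difK F i p q = 0 by rewrite mulr0.
  by apply/eqP; apply: contraT => /gd; rewrite hp => /esym.
apply: eq_bigr => p _; rewrite [in RHS]mxE.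
case: eqP => // hp; suff -> : difK F i p q = 0 by rewrite !mulr0.
by apply/eqP; apply: contraT => /gd; rewrite hq.
Qed.

Lemma gdeg_Tor_neq0 G i (p : 'I_(rk G i)) :
  minimal_graded_free_resolution A B G -> Tor_neq0 A B i (gdeg p).
Proof.
move=> [rG mG]; have d0 k : difK G k = 0 by apply/matrixP=> x y; rewrite !mxE mG.
exists G; split=> //; exists (delta_mx 0 p); split.
- by move=> q; rewrite mxE eqxx /=; have [->|] := eqVneq q p; rewrite ?eqxx.
- by case: (i) p => [|k] p //=; rewrite d0 mulmx0.
case=> w _; rewrite d0 mulmx0 => /matrixP /(_ 0 p).
by rewrite !mxE !eqxx => /eqP; rewrite oner_eq0.
Qed.

End Invariance.

(** * The Koszul strand *)

Section KoszulStrand.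
Variables (R : comNzRingType) (X Y Z : R).
Implicit Types (p q r v : nat -> nat -> R).

(* The boolean multiples state regularity modulo (0), (Y), (Z) and (Y, Z) at once. *)
Hypothesis regZ : forall a, Z * a = 0 -> a = 0.
Hypothesis regYZ : forall (e : bool) a c,
  Y * a = (Z *+ e) * c -> exists c', a = (Z *+ e) * c'.
Hypothesis regXYZ : forall (d e : bool) a b c,
  X * a = (Y *+ d) * b + (Z *+ e) * c ->
  exists b' c', a = (Y *+ d) * b' + (Z *+ e) * c'.

Definition supp_lt n v := forall a b, (n <= a + b)%N -> v a b = 0.

(* v a b is the coefficient of T1^a T2^b T3^(n-a-b) in a form of degree n; thus
   sh1, sh2 multiply by T1, T2, and D0 p q = p (Z T1 - X T3) + q (Y T2 - X T3). *)
Definition sh1 p a b := if a is a'.+1 then p a' b else 0.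
Definition sh2 p a b := if b is b'.+1 then p a b' else 0.

Definition D0 p q a b := (Z * sh1 p a b - X * p a b) + (Y * sh2 q a b - X * q a b).
Definition D1l r a b := Y * sh2 r a b - X * r a b.
Definition D1r r a b := X * r a b - Z * sh1 r a b.

(** This is (XY)^a (XZ)^b (YZ)^(s-a-b) with exponents collected. The collected form makes sense for
    all a, b <= s, so [evsum] can run over a square, whose two sums exchange freely, and leave the
    triangle to [supp_lt]. *)
Definition evmon s a b : R := X ^+ (a + b) * Y ^+ (s - b) * Z ^+ (s - a).
Definition evsum s v := \sum_(a < s.+1) \sum_(b < s.+1) v a b * evmon s a b.

Let regX a : X * a = 0 -> a = 0.
Proof.
move=> h; have [|b [c ->]] := @regXYZ false false a 0 0.
  by rewrite h !mul0r addr0.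
by rewrite !mul0r addr0.
Qed.

Let regY a : Y * a = 0 -> a = 0.
Proof.
move=> h; have [|c ->] := @regYZ false a 0; first by rewrite h mul0r.
by rewrite mul0r.
Qed.

Let syzYZ a b : Z * a + Y * b = 0 -> exists2 c, a = Y * c & b = - (Z * c).
Proof.
move=> h; have [|c hc] := @regYZ true b (- a).
  by rewrite mulr1n mulrN; apply/eqP; rewrite -subr_eq0 opprK addrC h.
rewrite mulr1n in hc; exists (- c); last by rewrite mulrN opprK.
apply/eqP; rewrite -subr_eq0; apply/eqP/regZ.
by rewrite -[RHS]h hc; ring.
Qed.

Lemma eq_D0 p q p' q' a b : (forall a b, p a b = p' a b) ->
  (forall a b, q a b = q' a b) -> D0 p q a b = D0 p' q' a b.
Proof. by move=> ep eq; rewrite /D0 ep eq; case: a b => [|a] [|b] /=; rewrite ?ep ?eq. Qed.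

Lemma D0_D1 r a b : D0 (D1l r) (D1r r) a b = 0.
Proof. by case: a b => [|a] [|b]; rewrite /D0 /D1l /D1r /=; ring. Qed.

(** Multiplication by Y T2 - X T3 is injective because X is regular: once the coefficient at T2^b
    vanishes, the next one is killed by X. *)
Lemma D1_inj r : (forall a b, D1l r a b = 0) -> forall a b, r a b = 0.
Proof.
move=> h a b; apply: regX; elim: b => [|b IHb]; have := h a.
  by move=> /(_ 0%N); rewrite /D1l /= mulr0 sub0r => /eqP; rewrite oppr_eq0 => /eqP.
by move=> /(_ b.+1); rewrite /D1l /= (regX IHb) mulr0 sub0r => /eqP; rewrite oppr_eq0 => /eqP.
Qed.

Lemma D0D p q p' q' a b :
  D0 (fun a b => p a b + p' a b) (fun a b => q a b + q' a b) a b = D0 p q a b + D0 p' q' a b.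
Proof. by rewrite /D0; case: a b => [|a] [|b] /=; ring. Qed.

Lemma D0N p q a b : D0 (fun a b => - p a b) (fun a b => - q a b) a b = - D0 p q a b.
Proof. by rewrite /D0; case: a b => [|a] [|b] /=; ring. Qed.

Lemma D0B p q p' q' a b :
  D0 (fun a b => p a b - p' a b) (fun a b => q a b - q' a b) a b = D0 p q a b - D0 p' q' a b.
Proof. by rewrite -D0N -D0D. Qed.

(* The relations on the top diagonal a + b = n only involve the coefficients Y and
   Z, so they split off the top diagonal of r; then n decreases. *)
Lemma D0_exact n p q : supp_lt n p -> supp_lt n q -> (forall a b, D0 p q a b = 0) ->
  exists r, [/\ supp_lt n.-1 r, forall a b, p a b = D1l r a b
             & forall a b, q a b = D1r r a b].
Proof.
elim: n p q => [|n IHn] p q hp hq h.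
  exists (fun _ _ => 0); split=> // a b; rewrite ?hp ?hq //.
    by rewrite /D1l; case: b => [|b] /=; ring.
  by rewrite /D1r; case: a => [|a] /=; ring.
have top a b : (a + b)%N = n.+1 -> Z * sh1 p a b + Y * sh2 q a b = 0.
  by move=> e; rewrite -(h a b) /D0 hp ?hq ?e //; ring.
(* At the two ends of the diagonal a + b = n + 1 the relation has a single term, so the corner
   coefficients vanish; in between, the relations are syzygies of Z and Y, solved by [syzYZ]. *)
have p0 : p n 0%N = 0.
  by apply: regZ; have := top n.+1 0%N; rewrite /= mulr0 addr0; apply; rewrite addn0.
have q0 : q 0%N n = 0.
  by apply: regY; have := top 0%N n.+1; rewrite /= mulr0 add0r; apply.
have [r [hr hrp hrq]] : exists r, [/\ forall a b, (a + b).+1 != n -> r a b = 0,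
    forall a b, (a + b).+1 = n -> p a b.+1 = Y * r a b
  & forall a b, (a + b).+1 = n -> q a.+1 b = - (Z * r a b)].
  case: n hp hq top p0 q0 {IHn} => [|n] hp hq top p0 q0.
    by exists (fun _ _ => 0); split.
  have ex (i : 'I_n.+1) : exists c, p i (n - i).+1 = Y * c /\ q i.+1 (n - i)%N = - (Z * c).
    have [|c] := @syzYZ (p i (n - i).+1) (q i.+1 (n - i)%N); last by exists c.
    by apply: (top i.+1 (n - i).+1); case: i => i /=; lia.
  have [rr hrr] := fin_all_exists ex.
  exists (fun a b => if (a + b)%N == n then rr (inord a) else 0); split.
  - by move=> a b; rewrite eqSS => /negPf ->.
  - move=> a b [e]; rewrite e eqxx; have [] := hrr (inord a).
    by have [-> ->] : ((inord a : 'I_n.+1) = a :> nat /\ n - a = b)%N by rewrite inordK; lia.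
  - move=> a b [e]; rewrite e eqxx; have [] := hrr (inord a).
    by have [-> ->] : ((inord a : 'I_n.+1) = a :> nat /\ n - a = b)%N by rewrite inordK; lia.
have [|||r' [hr' er'p er'q]] := IHn (fun a b => p a b - D1l r a b) (fun a b => q a b - D1r r a b).
- move=> a b hab; rewrite /D1l (hr a b) ?mulr0 ?subr0; last by lia.
  have [/eqP e|ne] := boolP ((a + b)%N == n).
    case: b e {hab} => [|b] /= e; first by rewrite mulr0 subr0 -p0 -e addn0.
    by rewrite hrp ?subrr //; lia.
  rewrite hp; last by lia.
  by case: b hab ne => [|b] /= hab ne; rewrite ?hr ?mulr0 ?subr0 //; lia.
- move=> a b hab; rewrite /D1r (hr a b) ?mulr0 ?sub0r ?opprK; last by lia.
  have [/eqP e|ne] := boolP ((a + b)%N == n).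
    case: a e {hab} => [|a] /= e; first by rewrite mulr0 addr0 -q0 -e.
    by rewrite hrq ?addNr //; lia.
  rewrite hq; last by lia.
  by case: a hab ne => [|a] /= hab ne; rewrite ?hr ?mulr0 ?addr0 //; lia.
- by move=> a b; rewrite D0B h D0_D1 subrr.
exists (fun a b => r a b + r' a b); split.
- move=> a b hab; rewrite hr ?hr' ?addr0 //; lia.
- move=> a b; rewrite -[p a b](subrK (D1l r a b)) er'p /D1l.
  by case: b => [|b] /=; ring.
- move=> a b; rewrite -[q a b](subrK (D1r r a b)) er'q /D1r.
  by case: a => [|a] /=; ring.
Qed.

Lemma evsumD s v w : evsum s (fun a b => v a b + w a b) = evsum s v + evsum s w.
Proof.
rewrite /evsum -big_split; apply: eq_bigr => a _ /=.
by rewrite -big_split; apply: eq_bigr => b _ /=; rewrite mulrDl.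
Qed.

(** Both Koszul relations die because Z (XY) = X (YZ) and Y (XZ) = X (YZ). Shifting a, respectively
    b, by one pairs the terms; the unpaired last one vanishes by [supp_lt]. *)
Lemma evsum_D0 s p q : supp_lt s p -> supp_lt s q -> evsum s (D0 p q) = 0.
Proof.
move=> hp hq; rewrite /D0 evsumD [X in X + _]/evsum exchange_big /=.
rewrite big1 ?add0r => [|b _]; last first.
  rewrite (eq_bigr (fun a : 'I_s.+1 =>
    Z * sh1 p a b * evmon s a b - X * p a b * evmon s a b)); last first.
    by move=> a _; rewrite mulrBl.
  rewrite sumrB big_ord_recl /= mulr0 mul0r add0r [X in _ - X]big_ord_recr /=.
  rewrite (hp s b) ?leq_addr // mulr0 mul0r addr0 -sumrB big1 // => -[a ha] _.
  rewrite /evmon /bump /= add1n; have -> : (s - a = (s - a.+1).+1)%N by lia.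
  by rewrite addSn !exprS; ring.
rewrite /evsum big1 // => a _.
rewrite (eq_bigr (fun b : 'I_s.+1 =>
  Y * sh2 q a b * evmon s a b - X * q a b * evmon s a b)); last first.
  by move=> b _; rewrite mulrBl.
rewrite sumrB big_ord_recl /= mulr0 mul0r add0r [X in _ - X]big_ord_recr /=.
rewrite (hq a s) ?leq_addl // mulr0 mul0r addr0 -sumrB big1 // => -[b hb] _.
rewrite /evmon /bump /= add1n; have -> : (s - b = (s - b.+1).+1)%N by lia.
by rewrite addnS !exprS; ring.
Qed.

Let regYZn m (e : bool) a c :
  Y ^+ m * a = (Z *+ e) * c -> exists c', a = (Z *+ e) * c'.
Proof.
elim: m a c => [|m IHm] a c; first by rewrite mul1r; exists c.
by rewrite exprSr -mulrA => /IHm [c' /regYZ].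
Qed.

Let regXYZn m (d e : bool) a b c :
  X ^+ m * a = (Y *+ d) * b + (Z *+ e) * c ->
  exists b' c', a = (Y *+ d) * b' + (Z *+ e) * c'.
Proof.
elim: m a b c => [|m IHm] a b c; first by rewrite mul1r; exists b, c.
by rewrite exprSr -mulrA => /IHm [b' [c' /regXYZ]].
Qed.

Let regZn m a : Z ^+ m * a = 0 -> a = 0.
Proof.
elim: m a => [|m IHm] a; first by rewrite mul1r.
by rewrite exprSr -mulrA => /IHm /regZ.
Qed.

(* Comparing the exponents of Z, then of Y, in the terms of the sum. *)
Lemma evsum_last_coef s k n v : (k + n <= s)%N ->
    (forall a b, (k < a)%N || (k == a) && (n < b)%N -> v a b = 0) -> evsum s v = 0 ->
  exists w w', v k n = (Y *+ (0 < n)%N) * w + (Z *+ (0 < k)%N) * w'.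
Proof.
move=> hkn hv.
pose U := \sum_(a < k) \sum_(b < s.+1) v a b * X ^+ (a + b) * Y ^+ (s - b) * Z ^+ (k - a.+1).
pose W := \sum_(b < n) v k b * X ^+ (k + b) * Y ^+ (n - b.+1).
(* Terms with a < k carry an extra factor Z, those with a = k and b < n an extra Y. If k = 0 or n =
   0 there are no such terms, and Z or Y drops out of the ideal; the booleans record this. *)
have hU : (0 < k)%N = false -> U = 0 by case: (k) @U => // U _; rewrite /U big_ord0.
have hW : (0 < n)%N = false -> W = 0 by case: (n) @W => // W _; rewrite /W big_ord0.
have -> : evsum s v =
    Z ^+ (s - k) * (Z * U + Y ^+ (s - n) * (Y * W + X ^+ (k + n) * v k n)).
  rewrite /evsum -(big_mkord xpredT (fun a => \sum_(b < s.+1) v a b * evmon s a b)).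
  rewrite (@big_cat_nat _ _ _ k) //=; last by lia.
  rewrite big_mkord big_ltn; last by lia.
  rewrite [X in _ + (_ + X)]big_nat [X in _ + (_ + X)]big1 ?addr0; last first.
    move=> a /andP[ka _]; rewrite big1 // => b _; rewrite hv ?mul0r //; lia.
  rewrite mulrDr; congr (_ + _).
    rewrite /U !mulr_sumr; apply: eq_bigr => a _; rewrite !mulr_sumr; apply: eq_bigr => b _.
    rewrite /evmon (_ : (s - a = (s - k) + (k - a.+1).+1)%N); last by case: a => a /=; lia.
    by rewrite [Z ^+ (_ + _)]exprD exprS; ring.
  rewrite -(big_mkord xpredT (fun b => v k b * evmon s k b)).
  rewrite (@big_cat_nat _ _ _ n) //=; last by lia.
  rewrite big_mkord big_ltn; last by lia.
  rewrite [X in _ + (_ + X)]big_nat [X in _ + (_ + X)]big1 ?addr0; last first.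
    by move=> b /andP[nb _]; rewrite hv ?mul0r //; lia.
  rewrite !mulrDr; congr (_ + _); last by rewrite /evmon; ring.
  rewrite /W !mulr_sumr; apply: eq_bigr => b _.
  rewrite /evmon (_ : (s - b = (s - n) + (n - b.+1).+1)%N); last by case: b => b /=; lia.
  by rewrite [Y ^+ (_ + _)]exprD exprS; ring.
move/regZn => e; have [|c hc] := @regYZn (s - n) (0 < k)%N (Y * W + X ^+ (k + n) * v k n) (- U).
  case: (0 < k)%N hU e => [_ /= e|/(_ erefl) ->].
    by rewrite mulr1n mulrN; apply/eqP; rewrite -subr_eq0 opprK addrC e.
  by rewrite mulr0 add0r oppr0 mulr0.
apply: (@regXYZn (k + n) _ _ _ (- W) c); rewrite -hc.
case: (0 < n)%N hW => [_|/(_ erefl) ->]; rewrite ?mulr1n; ring.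
Qed.

(** Elimination in the lexicographic order of (a, b). The last coefficient lies in (Y, Z), so it is
    the leading term of a combination of the two relations, whose X terms sit at (k - 1, n) and (k,
    n - 1), both earlier in the order. *)
Lemma evsum_exact s v : supp_lt s.+1 v -> evsum s v = 0 ->
  exists p q, [/\ supp_lt s p, supp_lt s q & forall a b, v a b = D0 p q a b].
Proof.
suff main k n w : (forall a b, (k < a)%N || (k == a) && (n <= b)%N -> w a b = 0) ->
    supp_lt s.+1 w -> evsum s w = 0 ->
    exists p q, [/\ supp_lt s p, supp_lt s q & forall a b, w a b = D0 p q a b].
  by move=> hv ev0; apply: (main s s.+1) => // a b hab; apply: hv; lia.
have step k' n' u :
    (forall a b, (k' < a)%N || (k' == a) && (n' < b)%N -> u a b = 0) ->
    supp_lt s.+1 u -> evsum s u = 0 ->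
    exists p q, [/\ supp_lt s p, supp_lt s q
      & forall a b, (k' < a)%N || (k' == a) && (n' <= b)%N -> u a b = D0 p q a b].
  move=> hu su eu; have [hs|hs] := leqP (k' + n') s; last first.
    exists (fun _ _ => 0), (fun _ _ => 0); split=> // a b hab.
    have -> : u a b = 0.
      by have [/andP[/eqP <- /eqP <-]|ne] := boolP ((k' == a) && (n' == b));
        [apply: su | apply: hu; lia].
    by rewrite /D0; case: a b {hab} => [|a] [|b] /=; ring.
  have [c [c' hc]] := evsum_last_coef hs hu eu.
  (* T1 raises (k' - 1, n') to (k', n') with coefficient Z, and T2 raises (k', n' - 1) with
     coefficient Y. If k' or n' is 0 the corresponding function is zero, in agreement with the
     boolean multiples in [hc]. *)
  pose p a b := if (a.+1 == k') && (b == n') then c' else 0.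
  pose q a b := if (a == k') && (b.+1 == n') then c else 0.
  exists p, q; split=> [a b hab|a b hab|a b hab].
  - by rewrite /p; case: ifP => //; lia.
  - by rewrite /q; case: ifP => //; lia.
  rewrite /D0; have -> : p a b = 0 by rewrite /p; case: ifP => //; lia.
  have -> : q a b = 0 by rewrite /q; case: ifP => //; lia.
  rewrite !mulr0 !subr0; have [/andP[/eqP ea /eqP eb]|ne] :=
      boolP ((k' == a) && (n' == b)).
    rewrite -ea -eb hc addrC; congr (_ + _).
      by case: (k') @p => [|j] p /=; rewrite /p ?eqxx ?mulr1n // mul0r mulr0.
    by case: (n') @q => [|j] q /=; rewrite /q ?eqxx ?mulr1n // mul0r mulr0.
  rewrite hu; last by lia.
  have -> : sh1 p a b = 0.
    by case: a hab ne => [|a] //= hab ne; rewrite /p; case: ifP => //; lia.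
  have -> : sh2 q a b = 0.
    by case: b hab ne => [|b] //= hab ne; rewrite /q; case: ifP => //; lia.
  by rewrite !mulr0 addr0.
have suppN n' p : supp_lt n' p -> supp_lt n' (fun a b => - p a b).
  by move=> hp a b /hp ->; rewrite oppr0.
have red k' n' u :
    (forall u', (forall a b, (k' < a)%N || (k' == a) && (n' <= b)%N -> u' a b = 0) ->
      supp_lt s.+1 u' -> evsum s u' = 0 ->
      exists p q, [/\ supp_lt s p, supp_lt s q & forall a b, u' a b = D0 p q a b]) ->
    (forall a b, (k' < a)%N || (k' == a) && (n' < b)%N -> u a b = 0) ->
    supp_lt s.+1 u -> evsum s u = 0 ->
    exists p q, [/\ supp_lt s p, supp_lt s q & forall a b, u a b = D0 p q a b].
  move=> rec hu su eu; have [p [q [sp sq e]]] := step k' n' u hu su eu.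
  have [a b hab|a b hab||p' [q' [sp' sq' e']]] := rec (fun a b => u a b - D0 p q a b).
  - by rewrite e ?subrr.
  - have sa (f : nat -> nat -> R) : supp_lt s f -> f a b = 0.
      by move=> sf; apply: sf; lia.
    rewrite su // /D0 (sa p) // (sa q) // !mulr0 !subr0 sub0r.
    by case: a b hab {sa} => [|a] [|b] hab /=; rewrite ?sp ?sq ?mulr0 ?addr0 ?oppr0 //; lia.
  - rewrite evsumD eu add0r -[RHS](evsum_D0 (suppN _ _ sp) (suppN _ _ sq)).
    by rewrite /evsum; apply: eq_bigr => a _; apply: eq_bigr => b _; rewrite D0N.
  exists (fun a b => p a b + p' a b), (fun a b => q a b + q' a b); split.
  - by move=> a b hab; rewrite sp ?sp' ?addr0.
  - by move=> a b hab; rewrite sq ?sq' ?addr0.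
  by move=> a b; rewrite D0D -e' addrC subrK.
elim: k n w => [|k IHk]; elim=> [|n IHn] w hw sw ew.
- exists (fun _ _ => 0), (fun _ _ => 0); split=> // a b.
  rewrite hw; last by lia.
  by rewrite /D0; case: a b => [|a] [|b] /=; ring.
- exact: red IHn hw sw ew.
(* Row k + 1 is cleared; row k can start at s + 1, since beyond it the support condition gives
   zero. *)
- apply: (IHk s.+1) => // a b hab.
  by have [hs|hs] := leqP s.+1 (a + b); [exact: sw | apply: hw; lia].
- exact: red IHn hw sw ew.
Qed.

End KoszulStrand.

(** * Monomials with disjoint supports *)

Section MonomialIdeals.
Variables (K : fieldType) (n : nat).
Local Notation R := {mpoly K[n]}.
Implicit Types (m k : 'X_{1..n}) (f g a b c : R).

Definition mdisjoint m m' := forall i, (m i == 0)%N || (m' i == 0)%N.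

Lemma mdisjoint_leD m m' k : mdisjoint m m' -> (m <= m' + k)%MM -> (m <= k)%MM.
Proof.
move=> h /mnm_lepP le; apply/mnm_lepP => i; have := le i; rewrite mnmDE.
by case/orP: (h i) => /eqP ->.
Qed.

Lemma mcoeffXM_neq0 m g k : ('X_[m] * g)@_k != 0 -> (m <= k)%MM.
Proof.
rewrite -mcoeff_msupp mulrC (perm_mem (msuppMX _ _)) => /mapP[k' _ ->].
by rewrite lem_addr.
Qed.

Lemma mpolyX_dvd_part m (P : pred 'X_{1..n}) f : (forall k, P k -> (m <= k)%MM) ->
  exists g, \sum_(k <- msupp f | P k) f@_k *: 'X_[k] = 'X_[m] * g.
Proof.
move=> hP; exists (\sum_(k <- msupp f | P k) f@_k *: 'X_[k - m]).
rewrite mulr_sumr; apply: eq_bigr => k /hP hk.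
by rewrite -scalerAr -mpolyXD addmC submK.
Qed.

Lemma mpolyX_reg m f : 'X_[m] * f = 0 -> f = 0.
Proof.
move=> h; apply/mpolyP => k; have := mcoeffMX f m k.
by rewrite mulrC h !mcoeff0.
Qed.

(** A monomial k of a gives the monomial m1 + k on the right, hence divisible by the second or third
    monomial; disjoint supports transfer this divisibility to k. Sorting the monomials of a
    accordingly gives b' and c'. *)
Lemma mpolyX_reg2 m1 m2 m3 (d e : bool) a b c : mdisjoint m2 m1 -> mdisjoint m3 m1 ->
    'X_[m1] * a = ('X_[m2] *+ d) * b + ('X_[m3] *+ e) * c ->
  exists b' c', a = ('X_[m2] *+ d) * b' + ('X_[m3] *+ e) * c'.
Proof.
move=> h2 h3 h.
have ha k : a@_k != 0 -> d && (m2 <= k)%MM || e && (m3 <= k)%MM.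
  rewrite -(mcoeffMX a m1 k) mulrC h mcoeffD; apply: contraNT.
  rewrite negb_or => /andP[hd he].
  have z m (d' : bool) g : mdisjoint m m1 -> ~~ (d' && (m <= k)%MM) ->
      ('X_[m] *+ d' * g)@_(m1 + k) = 0.
    move=> hm; case: d'; last by rewrite mulr0n mul0r mcoeff0.
    rewrite mulr1n; apply: contraNeq => /mcoeffXM_neq0; exact: mdisjoint_leD.
  by rewrite !z ?addr0.
pose P k := d && (m2 <= k)%MM.
have [b' hb'] : exists b', \sum_(k <- msupp a | P k) a@_k *: 'X_[k] = 'X_[m2] *+ d * b'.
  rewrite /P; case: (d); first by rewrite mulr1n; apply: mpolyX_dvd_part.
  by exists 0; rewrite mulr0 big_pred0.
have [c' hc'] : exists c', \sum_(k <- msupp a | ~~ P k) a@_k *: 'X_[k] = 'X_[m3] *+ e * c'.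
  pose Q k := e && (m3 <= k)%MM.
  suff [c' hc'] : exists c', \sum_(k <- msupp a | ~~ P k && Q k) a@_k *: 'X_[k] = 'X_[m3] *+ e * c'.
    exists c'; rewrite -hc' big_seq_cond [RHS]big_seq_cond; apply: eq_bigl => k.
    have [ka /=|//] := boolP (k \in msupp a).
    by have := ha k; rewrite -mcoeff_msupp -/(P k) -/(Q k) => /(_ ka); case: (P k).
  rewrite /Q; case: (e).
    by rewrite mulr1n; apply: mpolyX_dvd_part => k /andP[].
  by exists 0; rewrite mulr0 big_pred0 // => k; rewrite andbF.
by exists b', c'; rewrite -hb' -hc' {1}(mpolyE a) (bigID P).
Qed.

Lemma mpolyX_reg1 m1 m2 (e : bool) a c : mdisjoint m2 m1 ->
    'X_[m1] * a = ('X_[m2] *+ e) * c ->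
  exists c', a = ('X_[m2] *+ e) * c'.
Proof.
move=> h e1; have [|b' [c']] := @mpolyX_reg2 m1 m2 m2 false e a 0 c h h.
  by rewrite mulr0 add0r.
by rewrite mulr0n mul0r add0r; exists c'.
Qed.

Definition mset (w : {set 'I_n}) : 'X_{1..n} := [multinom (i \in w : nat) | i < n].

Lemma mpolyX_mset (w : {set 'I_n}) : \prod_(v in w) 'X_v = 'X_[mset w] :> R.
Proof.
rewrite mpolyXE_id big_mkcond /=; apply: eq_bigr => i _.
by rewrite mnmE; case: (i \in w).
Qed.

Lemma mdeg_mset (w : {set 'I_n}) : mdeg (mset w) = #|w|.
Proof. by rewrite mdegE -sum1_card [RHS]big_mkcond; apply: eq_bigr => i _; rewrite mnmE. Qed.

Lemma mset_disjoint (w w' : {set 'I_n}) : [disjoint w & w'] -> mdisjoint (mset w) (mset w').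
Proof.
move=> h i; rewrite !mnmE.
by have [/(disjointFr h) ->|_] := boolP (i \in w).
Qed.

End MonomialIdeals.

(** * Rows indexed by a triangle *)

Section TriangularIndices.

Local Notation tri n := {x : 'I_n * 'I_n | (x.1 + x.2 < n)%N}.

Definition card_tri n : nat := #|{: tri n}|.
Definition tri1 n (i : 'I_(card_tri n)) : nat := (val (enum_val i)).1.
Definition tri2 n (i : 'I_(card_tri n)) : nat := (val (enum_val i)).2.

Lemma tri_lt n (i : 'I_(card_tri n)) : (tri1 i + tri2 i < n)%N.
Proof. exact: valP (enum_val i). Qed.

Lemma tri_inj n (i j : 'I_(card_tri n)) : tri1 i = tri1 j -> tri2 i = tri2 j -> i = j.
Proof.
move=> ea eb; apply/enum_val_inj/val_inj/eqP.
by rewrite /eq_op /= -!val_eqE /= [X in X && _]/eq_op /=; apply/andP; split; apply/eqP.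
Qed.

Lemma tri_idx n a b : (a + b < n)%N -> exists i : 'I_(card_tri n), tri1 i = a /\ tri2 i = b.
Proof.
move=> h; have ha : (a < n)%N by lia.
have hb : (b < n)%N by lia.
pose x : tri n := exist _ (Ordinal ha, Ordinal hb) h.
by exists (enum_rank x); rewrite /tri1 /tri2 enum_rankK.
Qed.

Lemma card_triE n : card_tri n = 'C(n.+1, 2).
Proof.
rewrite /card_tri card_sig -sum1_card big_mkcond /=.
rewrite -(pair_bigA _ (fun a b : 'I_n => if (a + b < n)%N then 1 else 0)%N) /=.
rewrite -bin2_sum big_mkord big_ord_recl add0n [RHS](reindex_inj rev_ord_inj) /=.
apply: eq_bigr => a _; rewrite -big_mkcond sum1_card /bump /= add1n.
have -> : (n - a.+1).+1 = (n - a)%N by case: a => a /=; lia.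
have h : (n - a <= n)%N by lia.
have inj : injective (widen_ord h) by move=> x y /(congr1 val) /= /val_inj.
rewrite -[RHS](card_ord (n - a)) -(card_image inj).
apply: eq_card => b; apply/idP/imageP => [|[c _ ->]]; rewrite unfold_in /=; last first.
  by case: c => c /=; lia.
move=> lt; have hb : (b < n - a)%N by lia.
by exists (Ordinal hb) => //; apply: val_inj.
Qed.

Variable R : comNzRingType.

(* The row v as a function on nat * nat, zero outside the triangle a + b < n. *)
Definition ext n (v : 'rV[R]_(card_tri n)) a b : R :=
  \sum_i v 0 i *+ ((tri1 i == a) && (tri2 i == b)).

Lemma ext_supp n (v : 'rV[R]_(card_tri n)) : supp_lt n (ext v).
Proof.
move=> a b hab; rewrite /ext big1 // => i _; have := tri_lt i.
by case: andP => [[/eqP -> /eqP ->]|//]; rewrite ltnNge hab.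
Qed.

Lemma ext_at n (v : 'rV[R]_(card_tri n)) i : ext v (tri1 i) (tri2 i) = v 0 i.
Proof.
rewrite /ext (bigD1 i) //= !eqxx mulr1n big1 ?addr0 // => j ne.
case: andP => // -[/eqP ea /eqP eb].
by rewrite (tri_inj ea eb) eqxx in ne.
Qed.

Lemma ext_eq n (v : 'rV[R]_(card_tri n)) f : supp_lt n f ->
  (forall i, v 0 i = f (tri1 i) (tri2 i)) -> forall a b, ext v a b = f a b.
Proof.
move=> hf hv a b; have [h|h] := leqP n (a + b); first by rewrite hf // ext_supp.
by have [i [<- <-]] := tri_idx h; rewrite ext_at.
Qed.

Lemma ext_surj n f : supp_lt n f -> exists v : 'rV[R]_(card_tri n), forall a b, ext v a b = f a b.
Proof.
move=> hf; exists (\row_i f (tri1 i) (tri2 i)); apply: ext_eq => // i.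
by rewrite mxE.
Qed.

Lemma ext_inj n (v w : 'rV[R]_(card_tri n)) : (forall a b, ext v a b = ext w a b) -> v = w.
Proof. by move=> h; apply/rowP => i; rewrite -!ext_at. Qed.

Lemma extD n (v w : 'rV[R]_(card_tri n)) a b : ext (v + w) a b = ext v a b + ext w a b.
Proof. by rewrite /ext -big_split; apply: eq_bigr => i _; rewrite mxE mulrnDl. Qed.

Lemma extN n (v : 'rV[R]_(card_tri n)) a b : ext (- v) a b = - ext v a b.
Proof. by rewrite /ext -sumrN; apply: eq_bigr => i _; rewrite mxE mulNrn. Qed.

Lemma ext0 n a b : ext (0 : 'rV[R]_(card_tri n)) a b = 0.
Proof. by rewrite /ext big1 // => i _; rewrite mxE mul0rn. Qed.

Lemma sh1_ext n (v : 'rV[R]_(card_tri n)) a b :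
  sh1 (ext v) a b = \sum_i v 0 i *+ (((tri1 i).+1 == a) && (tri2 i == b)).
Proof. by case: a => [|a] //=; rewrite big1. Qed.

Lemma sh2_ext n (v : 'rV[R]_(card_tri n)) a b :
  sh2 (ext v) a b = \sum_i v 0 i *+ ((tri1 i == a) && ((tri2 i).+1 == b)).
Proof. by case: b => [|b] //=; rewrite big1 // => i _; rewrite andbF. Qed.

Variables X Y Z : R.

(** Multiplication by Z T1 - X T3 from forms of degree n - 1 to forms of degree n. The exponent of
    T3 is implicit, so T3 leaves (a, b) unchanged. [shift2_mx] plays the same role for Y T2 - X
    T3. *)
Definition shift1_mx n : 'M[R]_(card_tri n, card_tri n.+1) := \matrix_(i, j)
  (Z *+ (((tri1 i).+1 == tri1 j) && (tri2 i == tri2 j))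
   - X *+ ((tri1 i == tri1 j) && (tri2 i == tri2 j))).

Definition shift2_mx n : 'M[R]_(card_tri n, card_tri n.+1) := \matrix_(i, j)
  (Y *+ ((tri1 i == tri1 j) && ((tri2 i).+1 == tri2 j))
   - X *+ ((tri1 i == tri1 j) && (tri2 i == tri2 j))).

Lemma ext_shift1 n (v : 'rV_(card_tri n)) a b :
  ext (v *m shift1_mx n) a b = Z * sh1 (ext v) a b - X * ext v a b.
Proof.
apply: (@ext_eq _ _ (fun a b => Z * sh1 (ext v) a b - X * ext v a b)) => [{}a {}b h|j].
  by case: a h => [|a] h /=; rewrite !ext_supp ?mulr0 ?subr0 //; lia.
rewrite mxE sh1_ext !mulr_sumr -sumrB; apply: eq_bigr => i _; rewrite mxE mulrBr.
by congr (_ - _); rewrite !mulrnAr mulrC.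
Qed.

Lemma ext_shift2 n (v : 'rV_(card_tri n)) a b :
  ext (v *m shift2_mx n) a b = Y * sh2 (ext v) a b - X * ext v a b.
Proof.
apply: (@ext_eq _ _ (fun a b => Y * sh2 (ext v) a b - X * ext v a b)) => [{}a {}b h|j].
  by case: b h => [|b] h /=; rewrite !ext_supp ?mulr0 ?subr0 //; lia.
rewrite mxE sh2_ext !mulr_sumr -sumrB; apply: eq_bigr => i _; rewrite mxE mulrBr.
by congr (_ - _); rewrite !mulrnAr mulrC.
Qed.

Lemma evsum_ext s (v : 'rV_(card_tri s.+1)) :
  evsum X Y Z s (ext v) = \sum_i v 0 i * evmon X Y Z s (tri1 i) (tri2 i).
Proof.
transitivity (\sum_(i < card_tri s.+1) \sum_(a < s.+1) \sum_(b < s.+1)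
    v 0 i *+ ((tri1 i == a) && (tri2 i == b)) * evmon X Y Z s a b).
  rewrite exchange_big /=; apply: eq_bigr => a _.
  by rewrite exchange_big /=; apply: eq_bigr => b _; rewrite mulr_suml.
apply: eq_bigr => i _; have := tri_lt i => hi.
have ha : (tri1 i < s.+1)%N by lia.
have hb : (tri2 i < s.+1)%N by lia.
rewrite (bigD1 (Ordinal ha)) //= (bigD1 (Ordinal hb)) //= !eqxx mulr1n.
rewrite big1 ?addr0 => [|b nb]; last first.
  by have /negPf -> : tri2 i != b; [rewrite eq_sym; exact: nb | rewrite andbF mul0r].
rewrite big1 ?addr0 // => a na; apply: big1 => b _.
by have /negPf -> : tri1 i != a; [rewrite eq_sym; exact: na | rewrite mul0r].
Qed.

End TriangularIndices.

(** * Ideals and the complex of the triangle *)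

Section IdealGen.
Variable R : comNzRingType.
Implicit Types (S T P : R -> Prop) (f g : R).

Lemma ideal_gen_min S P : P 0 -> (forall a f g, P f -> S g -> P (f + a * g)) ->
  forall f, ideal_gen S f -> P f.
Proof.
move=> P0 Pl f [k [c [g [hg ->]]]]; elim: k c g hg => [|k IHk] c g hg.
  by rewrite big_ord0.
rewrite big_ord_recr /=; apply: Pl => //.
by apply: (IHk (c \o widen_ord (leqnSn k)) (g \o widen_ord (leqnSn k))) => i; apply: hg.
Qed.

Lemma ideal_gen_lin S a f g : ideal_gen S f -> ideal_gen S g -> ideal_gen S (f + a * g).
Proof.
move=> [k [c [u [hu ->]]]] [k' [c' [u' [hu' ->]]]].
exists (k + k')%N, (fun i => match split i with inl j => c j | inr j => a * c' j end),
  (fun i => match split i with inl j => u j | inr j => u' j end); split.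
  by move=> i; case: (split i).
rewrite big_split_ord mulr_sumr /=; congr (_ + _); apply: eq_bigr => i _.
  by rewrite (unsplitK (inl i)).
by rewrite (unsplitK (inr i)) mulrA.
Qed.

Lemma ideal_gen0 S : ideal_gen S 0.
Proof. by exists 0%N, (fun=> 0), (fun=> 0); split=> [[]|] //; rewrite big_ord0. Qed.

Lemma ideal_gen_incl S g : S g -> ideal_gen S g.
Proof. by exists 1%N, (fun=> 1), (fun=> g); split=> //; rewrite big_ord1 mul1r. Qed.

Lemma ideal_genMl S a g : ideal_gen S g -> ideal_gen S (a * g).
Proof. by rewrite -[a * g]add0r; apply: ideal_gen_lin; exact: ideal_gen0. Qed.

Lemma ideal_gen_sub S T : (forall f, S f -> ideal_gen T f) ->
  forall f, ideal_gen S f -> ideal_gen T f.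
Proof.
move=> h; apply: ideal_gen_min => [|a f g hf /h hg]; first exact: ideal_gen0.
exact: ideal_gen_lin.
Qed.

Lemma ideal_genM S T U : (forall f g, S f -> T g -> U (f * g)) ->
  forall f g, ideal_gen S f -> ideal_gen T g -> ideal_gen U (f * g).
Proof.
move=> h f g hf hg; move: f hf; apply: ideal_gen_min => [|a f' s hf' hs].
  by rewrite mul0r; exact: ideal_gen0.
rewrite mulrDl -mulrA; apply: ideal_gen_lin => //.
move: g hg {hf'}; apply: ideal_gen_min => [|b g' t hg' ht].
  by rewrite mulr0; exact: ideal_gen0.
rewrite mulrDr mulrCA; apply: ideal_gen_lin => //.
exact/ideal_gen_incl/h.
Qed.

Variables X Y Z : R.

Definition tri_gen s f : Prop := exists a b, (a + b <= s)%N /\ f = evmon X Y Z s a b.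

Lemma evmonM s a b a' b' : (a + b <= s)%N -> (a' + b' <= 1)%N ->
  evmon X Y Z s a b * evmon X Y Z 1 a' b' = evmon X Y Z s.+1 (a + a') (b + b').
Proof.
move=> h h'; rewrite /evmon.
have -> : (s.+1 - (b + b') = (s - b) + (1 - b'))%N by lia.
have -> : (s.+1 - (a + a') = (s - a) + (1 - a'))%N by lia.
by rewrite addnACA !exprD; ring.
Qed.

(** Induction peels off a factor XY if a > 0, else XZ if b > 0, else YZ. The family g is indexed by
    nat so that a factor can be appended. *)
Lemma tri_gen_prod s f : tri_gen s f ->
  exists g : nat -> R, (forall i, tri_gen 1 (g i)) /\ f = \prod_(i < s) g i.
Proof.
elim: s f => [|s IHs] f [a [b [hab ->]]].
  have [-> ->] : (a = 0 /\ b = 0)%N by lia.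
  exists (fun=> evmon X Y Z 1 0 0); split; first by exists 0%N, 0%N.
  by rewrite big_ord0 /evmon !expr0 !mulr1.
suff [a0 [b0 [a' [b' [h0 h' [ea eb]]]]]] : exists a0 b0 a' b',
    [/\ (a0 + b0 <= s)%N, (a' + b' <= 1)%N & (a = a0 + a' /\ b = b0 + b')%N].
  have [|g [hg eg]] := IHs (evmon X Y Z s a0 b0); first by exists a0, b0.
  exists (fun i => if i == s then evmon X Y Z 1 a' b' else g i); split.
    by move=> i; case: ifP => // _; exists a', b'.
  rewrite big_ord_recr /= eqxx ea eb -evmonM // eg; congr (_ * _).
  by apply: eq_bigr => i _; rewrite ltn_eqF.
case: a hab => [|a] hab; last by exists a, b, 1%N, 0%N; split; lia.
case: b hab => [|b] hab; last by exists 0%N, b, 0%N, 1%N; split; lia.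
by exists 0%N, 0%N, 0%N, 0%N.
Qed.

Lemma ideal_pow_tri_gen J s : (forall f, J f <-> ideal_gen (tri_gen 1) f) ->
  forall f, ideal_pow J s f <-> ideal_gen (tri_gen s) f.
Proof.
move=> hJ f; split; apply: ideal_gen_sub => {}f.
  case=> g [hg ->]; elim: s g hg => [|s IHs] g hg.
    rewrite big_ord0; apply: ideal_gen_incl; exists 0%N, 0%N; split=> //.
    by rewrite /evmon !expr0 !mulr1.
  rewrite big_ord_recr /=.
  have h1 := IHs (fun i => g (widen_ord (leqnSn s) i)) (fun i => hg _).
  have /hJ h2 := hg ord_max.
  apply: ideal_genM h1 h2 => _ _ [a [b [h ->]]] [a' [b' [h' ->]]].
  by exists (a + a')%N, (b + b')%N; rewrite evmonM //; split=> //; lia.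
move=> /tri_gen_prod [g [hg ->]]; apply: ideal_gen_incl.
by exists (fun i => g i); split=> // i; apply/hJ/ideal_gen_incl.
Qed.

End IdealGen.

(** * The graded complex over the polynomial ring and its exactness *)

Section TriangleComplex.
Variables (K : fieldType) (n : nat) (mx my mz : 'X_{1..n}).
Local Notation R := {mpoly K[n]}.
Local Notation X := ('X_[mx] : R).
Local Notation Y := ('X_[my] : R).
Local Notation Z := ('X_[mz] : R).
Hypotheses (hxy : mdisjoint my mx) (hxz : mdisjoint mz mx) (hyz : mdisjoint mz my).
Variable t : nat.
Local Notation s := t.+1.

(* The degree of the basis element of F_k indexed by (a, b). *)
Definition tri_deg (k a b : nat) : int :=
  ((a + b + k) * mdeg mx)%N%:Z + (s%:Z - b%:Z) * (mdeg my)%:Z + (s%:Z - a%:Z) * (mdeg mz)%:Z.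

(** Triangles of size s + 1, s and t = s - 1 index the monomials in T1, T2, T3 of degrees s, s - 1
    and s - 2. *)
Definition tri_rk i : nat :=
  match i with 0 => card_tri s.+1 | 1 => card_tri s + card_tri s | 2 => card_tri t | _ => 0 end.

Definition tri_gdeg i : 'I_(tri_rk i) -> int :=
  match i return 'I_(tri_rk i) -> int with
  | 0 => fun p => tri_deg 0 (tri1 p) (tri2 p)
  | 1 => fun p => match split p with inl u | inr u => tri_deg 1 (tri1 u) (tri2 u) end
  | 2 => fun p => tri_deg 2 (tri1 p) (tri2 p)
  | _ => fun=> 0
  end.

Definition tri_dif i : 'M[R]_(tri_rk i.+1, tri_rk i) :=
  match i return 'M[R]_(tri_rk i.+1, tri_rk i) with
  | 0 => col_mx (shift1_mx X Z s) (shift2_mx X Y s)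
  | 1 => row_mx (shift2_mx X Y t) (- shift1_mx X Z t)
  | _ => 0
  end.

Definition tri_seq : free_seq K n := FreeSeq tri_gdeg tri_dif.

Definition tri_aug : 'M[R]_(rk tri_seq 0, 1) := \col_i evmon X Y Z s (tri1 i) (tri2 i).

Lemma zhomogX m (d : int) : d = (mdeg m)%:Z -> zhomog d ('X_[m] : R).
Proof. by move=> ->; right; exists (mdeg m) => //; rewrite dhomogX /=. Qed.

Lemma zhomogB (d : int) (f g : R) : zhomog d f -> zhomog d g -> zhomog d (f - g).
Proof.
case=> [->|[k -> hf]] hg.
  rewrite sub0r; case: hg => [->|[k -> hg]]; first by left; rewrite oppr0.
  by right; exists k => //; rewrite rpredN.
case: hg => [->|[k' [<-] hg]]; first by rewrite subr0; right; exists k.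
by right; exists k => //; rewrite rpredB.
Qed.

Lemma zhomogMb (d : int) m (b : bool) : (b -> d = (mdeg m)%:Z) -> zhomog d (('X_[m] : R) *+ b).
Proof. by case: b => [/(_ erefl) e|_]; [apply: zhomogX | left]. Qed.

Lemma shift1_graded k m :
  graded_mx (fun i => tri_deg k.+1 (tri1 i) (tri2 i)) (fun i => tri_deg k (tri1 i) (tri2 i))
    (shift1_mx X Z m).
Proof.
move=> i j; rewrite mxE; apply: zhomogB; apply: zhomogMb => /andP[/eqP <- /eqP <-];
  rewrite /tri_deg; nia.
Qed.

Lemma shift2_graded k m :
  graded_mx (fun i => tri_deg k.+1 (tri1 i) (tri2 i)) (fun i => tri_deg k (tri1 i) (tri2 i))
    (shift2_mx X Y m).
Proof.
move=> i j; rewrite mxE; apply: zhomogB; apply: zhomogMb => /andP[/eqP <- /eqP <-];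
  rewrite /tri_deg; nia.
Qed.

Lemma zhomogN (d : int) (f : R) : zhomog d f -> zhomog d (- f).
Proof. by move=> h; rewrite -sub0r; apply: zhomogB => //; left. Qed.

Lemma tri_seq_graded i : graded_mx (@gdeg _ _ tri_seq i.+1) (@gdeg _ _ tri_seq i) (dif tri_seq i).
Proof.
case: i => [|[|i]] p q; last by left; rewrite /= mxE.
  rewrite /= mxE; case: (split p) => u; [exact: shift1_graded | exact: shift2_graded].
rewrite /= mxE; case: (split q) => u; first exact: shift2_graded.
by rewrite mxE; apply: zhomogN; exact: shift1_graded.
Qed.

Lemma tri_aug_graded : graded_mx (@gdeg _ _ tri_seq 0) (fun=> 0) tri_aug.
Proof.
move=> p q; rewrite mxE /evmon !mpolyXn -!mpolyXD; apply: zhomogX.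
rewrite /= /tri_deg !mdegD !mdegMn; have := tri_lt p; nia.
Qed.

Lemma mpolyX_mcoeff0 m : m != 0%MM -> ('X_[m] : R)@_0%MM = 0.
Proof. by rewrite mcoeffX => /negPf ->. Qed.

Hypotheses (x0 : mx != 0%MM) (y0 : my != 0%MM) (z0 : mz != 0%MM).

Lemma tri_seq_minimal : minimal_seq tri_seq.
Proof.
have h1 k (i : 'I_(card_tri k)) j : (shift1_mx X Z k i j)@_0%MM = 0.
  by rewrite mxE mcoeffB !mcoeffMn !mpolyX_mcoeff0 // !mul0rn subrr.
have h2 k (i : 'I_(card_tri k)) j : (shift2_mx X Y k i j)@_0%MM = 0.
  by rewrite mxE mcoeffB !mcoeffMn !mpolyX_mcoeff0 // !mul0rn subrr.
case=> [|[|i]] p q; rewrite /= mxE ?mcoeff0 //; first by case: split.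
by case: split => u //; rewrite mxE mcoeffN h1 oppr0.
Qed.

Lemma tri_aug_mcoeff0 p q : (tri_aug p q)@_0%MM = 0.
Proof.
rewrite mxE /evmon !mpolyXn -!mpolyXD mpolyX_mcoeff0 //.
rewrite -mdeg_eq0 !mdegD !mdegMn; have := tri_lt p.
by move: x0 y0 z0; rewrite -!mdeg_eq0; nia.
Qed.

Let regZ (a : R) : Z * a = 0 -> a = 0. Proof. exact: mpolyX_reg. Qed.

Let regYZ (e : bool) (a c : R) : Y * a = (Z *+ e) * c -> exists c', a = (Z *+ e) * c'.
Proof. exact: mpolyX_reg1. Qed.

Let regXYZ (d e : bool) (a b c : R) : X * a = (Y *+ d) * b + (Z *+ e) * c ->
  exists b' c', a = (Y *+ d) * b' + (Z *+ e) * c'.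
Proof. exact: mpolyX_reg2. Qed.

Lemma tri_augE (v : 'rV_(card_tri s.+1)) : (v *m tri_aug) 0 0 = evsum X Y Z s (ext v).
Proof. by rewrite evsum_ext mxE; apply: eq_bigr => i _; rewrite [tri_aug _ _]mxE. Qed.

Lemma ext_dif0 (p q : 'rV_(card_tri s)) a b :
  ext (row_mx p q *m tri_dif 0) a b = D0 X Y Z (ext p) (ext q) a b.
Proof.
by rewrite mul_row_col extD ext_shift1 ext_shift2.
Qed.

Lemma ext_dif1l (r : 'rV_(card_tri t)) a b :
  ext (r *m shift2_mx X Y t) a b = D1l X Y (ext r) a b.
Proof. exact: ext_shift2. Qed.

Lemma ext_dif1r (r : 'rV_(card_tri t)) a b :
  ext (r *m - shift1_mx X Z t) a b = D1r X Z (ext r) a b.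
Proof. by rewrite mulmxN extN ext_shift1 opprB. Qed.

Lemma tri_seq_resolves :
  resolves (ideal_gen (tri_gen X Y Z s)) zero_ideal tri_aug.
Proof.
split; first by split; [exact: tri_aug_graded | exact: tri_seq_graded].
- move=> f; split.
    apply: (@ideal_gen_min _ _ (fun f =>
      exists v : 'rV_(card_tri s.+1), f - (v *m tri_aug) 0 0 = 0))
      => [|a {}f g [v hv] [a' [b' [h ->]]]].
      by exists 0; rewrite mul0mx mxE subrr.
    have [i [ea eb]] := @tri_idx s.+1 _ _ h.
    exists (v + a *: delta_mx 0 i); move: hv => /subr0_eq ->.
    by rewrite mulmxDl -scalemxAl -rowE !mxE ea eb subrr.
  case=> v /subr0_eq ->; rewrite mxE.
  exists (card_tri s.+1), (fun i => v 0 i), (fun i => tri_aug i 0); split=> // i.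
  by exists (tri1 i), (tri2 i); split; [have := tri_lt i | rewrite mxE].
- move=> v; rewrite /zero_ideal tri_augE; split.
    move=> /(evsum_exact regZ regYZ regXYZ (@ext_supp _ _ v)) [p [q [hp hq e]]].
    have [p' ep] := ext_surj hp; have [q' eq] := ext_surj hq.
    exists (row_mx p' q'); apply: ext_inj => a b; rewrite e ext_dif0.
    exact: eq_D0.
  case=> w ->; rewrite -[w]hsubmxK.
  rewrite -(evsum_D0 X Y Z (@ext_supp _ _ (lsubmx w)) (@ext_supp _ _ (rsubmx w))).
  by apply: eq_bigr => a _; apply: eq_bigr => b _; rewrite ext_dif0.
case=> [|[|i]] v.
- rewrite -[v]hsubmxK; set p := lsubmx v; set q := rsubmx v; split.
    move=> h; have e0 a b : D0 X Y Z (ext p) (ext q) a b = 0.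
      by rewrite -ext_dif0 [_ *m _]h ext0.
    have [r [hr ep eq]] := D0_exact regZ regYZ (@ext_supp _ _ p) (@ext_supp _ _ q) e0.
    have [r' er] := ext_surj hr; exists r'; rewrite mul_mx_row.
    by congr row_mx; apply: ext_inj => a b; rewrite ?ext_dif1l ?ext_dif1r ?ep ?eq
      /D1l /D1r er; [case: b => //= b | case: a => //= a]; rewrite er.
  case=> w ->; rewrite mul_mx_row; apply: ext_inj => a b; rewrite ext_dif0 ext0.
  rewrite -(D0_D1 X Y Z (ext w) a b).
  by apply: eq_D0 => {}a {}b; [exact: ext_dif1l | exact: ext_dif1r].
- split=> [|[w ->]]; last by rewrite mulmx0 mul0mx.
  rewrite mul_mx_row -[X in _ = X]row_mx0 => /eq_row_mx [h _].
  exists 0; rewrite mul0mx; apply: ext_inj => a b; rewrite ext0.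
  by apply: (D1_inj regXYZ) => {}a {}b; rewrite -ext_dif1l h ext0.
- have -> : v = 0 := thinmx0 _.
  by split=> _; [exists 0 |]; rewrite mul0mx.
Qed.

End TriangleComplex.

(** * The complete tripartite graph *)

Section QuotientResolution.
Variables (K : fieldType) (n : nat).
Local Notation R := {mpoly K[n]}.
Variables (A : R -> Prop) (F : free_seq K n) (E : 'M[R]_(rk F 0, 1)).

(* F with R put in front through its augmentation E: it resolves R / A. *)
Definition cone_rk i : nat := if i is i'.+1 then rk F i' else 1%N.

Definition cone_gdeg i : 'I_(cone_rk i) -> int :=
  match i return 'I_(cone_rk i) -> int with
  | 0 => fun=> 0
  | i'.+1 => @gdeg _ _ F i'
  end.

Definition cone_dif i : 'M[R]_(cone_rk i.+1, cone_rk i) :=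
  match i return 'M[R]_(cone_rk i.+1, cone_rk i) with
  | 0 => E
  | i'.+1 => dif F i'
  end.

Definition cone_seq : free_seq K n := FreeSeq cone_gdeg cone_dif.

Hypothesis rF : resolves A zero_ideal E.

(** A is the image of a graded map, so a component of an image is the image of suitable components.
    This makes A admissible as the B of the comparison for R / A. *)
Lemma resolves_homog : homog_ideal A.
Proof.
case: rF => [[gE _] hA _ _].
have {}hA f : A f <-> exists v : 'rV_(rk F 0), f = (v *m E) 0 0.
  split=> [/hA [v /subr0_eq ->]|[v ->]]; first by exists v.
  by apply/hA; exists v; rewrite /zero_ideal subrr.
split=> [|a f g /hA [v ->] /hA [w ->]|d f /hA [v ->]]; apply/hA.
- by exists 0; rewrite mul0mx mxE.
- by exists (v + a *: w); rewrite mulmxDl -scalemxAl !mxE.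
exists (\row_i zcomp (d - gdeg i) (v 0 i)); rewrite !mxE zcomp_sum.
by apply: eq_bigr => i _; rewrite mxE (zcompM _ _ (gE i 0)) subr0.
Qed.

Lemma cone_resolution : graded_free_resolution unit_ideal A cone_seq.
Proof.
have [A0 _ _] := resolves_homog; case: rF => [[gE gF] hA h0 h].
exists 1%:M; split.
- split=> [p q|[|i] p q]; last exact: gF.
    by rewrite !ord1 mxE; right; exists 0%N => //; exact: dhomog1.
  by have := gE p q; rewrite /= !subr0.
- by move=> f; split=> // _; exists f%:M; rewrite mulmx1 mxE eqxx mulr1n subrr.
- move=> v; rewrite mulmx1 hA; split=> -[w].
    by move/subr0_eq => e; exists w; apply/rowP => i; rewrite ord1 -e.
  by move=> ->; exists w; rewrite /zero_ideal subrr.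
case=> [|i] v; last exact: h.
rewrite -h0; split=> [e|e]; first by rewrite [v *m E]e /zero_ideal mxE.
by apply/rowP => i; rewrite ord1 [RHS]mxE.
Qed.

End QuotientResolution.

(** * Vertex covers of the complete tripartite graph *)

Section Tripartite.
Variables (m1 m2 m3 : nat).

Lemma tripart_lshift2 (i : 'I_m1) : tripart (lshift m3 (lshift m2 i)) = 0.
Proof. by rewrite /tripart (unsplitK (inl _)) (unsplitK (inl _)). Qed.

Lemma tripart_rlshift (i : 'I_m2) : tripart (lshift m3 (rshift m1 i)) = 1.
Proof. by rewrite /tripart (unsplitK (inl _)) (unsplitK (inr _)). Qed.

Lemma tripart_rshift (i : 'I_m3) : tripart (rshift (m1 + m2) i) = 2.
Proof. by rewrite /tripart (unsplitK (inr _)). Qed.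

Definition part k : {set 'I_(m1 + m2 + m3)} := [set v | tripart v == k].

Lemma card_part k : #|part k| = (m1 * (k == 0) + m2 * (k == 1) + m3 * (k == 2))%N.
Proof.
rewrite -sum1dep_card big_mkcond big_split_ord big_split_ord /=.
rewrite (eq_bigr (fun=> (k == 0) : nat)); last first.
  by move=> i _; rewrite tripart_lshift2 eq_sym; case: eqP.
rewrite [X in (_ + X + _)%N](eq_bigr (fun=> (k == 1) : nat)); last first.
  by move=> i _; rewrite tripart_rlshift eq_sym; case: eqP.
rewrite [X in (_ + X)%N](eq_bigr (fun=> (k == 2) : nat)); last first.
  by move=> i _; rewrite tripart_rshift eq_sym; case: eqP.
by rewrite !sum_nat_const !card_ord.
Qed.

Lemma disjoint_part k k' : k != k' -> [disjoint part k & part k'].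
Proof.
move=> ne; apply/pred0P => v /=; rewrite !inE.
by apply/negP => /andP[/eqP -> /eqP e]; rewrite e eqxx in ne.
Qed.

Lemma partU_cover i j k :
    (forall v : 'I_(m1 + m2 + m3), [|| tripart v == i, tripart v == j | tripart v == k]) ->
  is_vertex_cover (complete_tripartite m1 m2 m3) (part i :|: part j).
Proof.
move=> h; apply/forallP => u; apply/forallP => v; apply/implyP.
rewrite /complete_tripartite !inE; have := h u; have := h v.
case: (tripart u =P i) => //= _; case: (tripart u =P j) => //= _.
case: (tripart v =P i) => //= _; case: (tripart v =P j) => //= _.
by move=> /eqP -> /eqP ->; rewrite eqxx.
Qed.

Lemma tripart_cases (v : 'I_(m1 + m2 + m3)) :
  [|| tripart v == 0, tripart v == 1 | tripart v == 2]%N.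
Proof. by rewrite /tripart; case: split => // u; case: split. Qed.

(** A cover that misses a vertex of one part contains all its neighbours, that is, both other
    parts. *)
Lemma cover_part (w : {set 'I_(m1 + m2 + m3)}) :
  is_vertex_cover (complete_tripartite m1 m2 m3) w ->
  [\/ part 0 :|: part 1 \subset w, part 0 :|: part 2 \subset w | part 1 :|: part 2 \subset w].
Proof.
move=> /forallP cw.
have miss k : ~~ (part k \subset w) -> forall v, tripart v != k -> v \in w.
  case/subsetPn => u; rewrite inE => /eqP <- uw v ne.
  have /forallP/(_ v)/implyP := cw u; rewrite /complete_tripartite eq_sym => /(_ ne).
  by rewrite (negPf uw).
have [h0|/miss h0] := boolP (part 0 \subset w); last first.
  by constructor 3; apply/subsetP => v; rewrite !inE => h; apply: h0; case/orP: h => /eqP ->.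
have [h1|/miss h1] := boolP (part 1 \subset w); last first.
  by constructor 2; apply/subsetP => v; rewrite !inE => h; apply: h1; case/orP: h => /eqP ->.
by constructor 1; rewrite subUset h0.
Qed.

Variable K : fieldType.
Local Notation R := {mpoly K[m1 + m2 + m3]}.
Local Notation X := ('X_[mset (part 0)] : R).
Local Notation Y := ('X_[mset (part 1)] : R).
Local Notation Z := ('X_[mset (part 2)] : R).

Lemma prod_partU i j : i != j ->
  \prod_(v in part i :|: part j) 'X_v = 'X_[mset (part i)] * 'X_[mset (part j)] :> R.
Proof.
move=> /disjoint_part ne; rewrite -!mpolyX_mset -bigU //.
by apply: eq_bigl => v; rewrite in_setU.
Qed.

Lemma cover_idealE f : cover_ideal K (complete_tripartite m1 m2 m3) f <->
  ideal_gen (tri_gen X Y Z 1) f.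
Proof.
have e01 : X * Y = evmon X Y Z 1 1 0 by rewrite /evmon !expr1 expr0 mulr1.
have e02 : X * Z = evmon X Y Z 1 0 1 by rewrite /evmon !expr1 expr0 mulr1.
have e12 : Y * Z = evmon X Y Z 1 0 0 by rewrite /evmon !expr1 expr0 mul1r.
split; apply: ideal_gen_sub => {}f.
  case=> w [/cover_part cw ->].
  have sub i j : i != j -> part i :|: part j \subset w ->
      exists g, \prod_(v in w) 'X_v = g * ('X_[mset (part i)] * 'X_[mset (part j)]) :> R.
    move=> ne hs; exists (\prod_(v in w :\: (part i :|: part j)) 'X_v).
    rewrite -prod_partU // (big_setID (part i :|: part j)) /= mulrC.
    by rewrite (setIidPr hs).
  have gen a b : (a + b <= 1)%N -> tri_gen X Y Z 1 (evmon X Y Z 1 a b) by exists a, b.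
  by case: cw => /sub [] // g ->; apply: ideal_genMl; apply: ideal_gen_incl;
    rewrite ?e01 ?e02 ?e12; exact: gen.
case=> a [b [hab ->]]; apply: ideal_gen_incl.
have [[-> ->]|[[-> ->]|[-> ->]]] : (a = 1 /\ b = 0) \/ (a = 0 /\ b = 1) \/ (a = 0 /\ b = 0) by lia.
- exists (part 0 :|: part 1); rewrite prod_partU // e01; split=> //.
  by apply: (@partU_cover 0 1 2) => v; exact: tripart_cases.
- exists (part 0 :|: part 2); rewrite prod_partU // e02; split=> //.
  by apply: (@partU_cover 0 2 1) => v; rewrite [(_ == 2) || _]orbC; exact: tripart_cases.
exists (part 1 :|: part 2); rewrite prod_partU // e12; split=> //.
by apply: (@partU_cover 1 2 0) => v; rewrite orbA orbC; exact: tripart_cases.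
Qed.

End Tripartite.

(** * The regularity formula as a maximum *)

Lemma big_maxn_ind (Q : nat -> Prop) (a b : nat) (P : pred nat) (F : nat -> nat) :
  Q 0 -> (forall i, (a <= i < b)%N -> P i -> Q (F i)) -> Q (\max_(a <= i < b | P i) F i).
Proof.
move=> Q0 h; rewrite big_nat_cond; apply: big_ind => // [x y hx hy|i /andP[]]; last exact: h.
by rewrite /maxn; case: ifP.
Qed.

Lemma leq_big_maxn (a b i : nat) (P : pred nat) (F : nat -> nat) :
  (a <= i < b)%N -> P i -> (F i <= \max_(a <= i < b | P i) F i)%N.
Proof. by move=> h Pi; apply: leq_bigmax_seq => //; rewrite mem_index_iota. Qed.

(** A maximum is one of its entries or the value 0 of an empty [\max], whence the hypothesis Q 0. *)
Lemma tri_reg_ind (Q : nat -> Prop) m1 m2 m3 s : Q 0 ->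
    (forall a b c, (a + b + c)%N = s -> Q (tri_alpha m1 m2 m3 s a b c)) ->
    (forall a b c, (a.+1 + b + c)%N = s -> Q (tri_alpha m1 m2 m3 s a.+1 b c + m3 - 1)%N) ->
    (forall a b c, (a.+2 + b + c)%N = s -> Q (tri_alpha m1 m2 m3 s a.+2 b c + 2 * m3 - 2)%N) ->
  Q (tri_reg m1 m2 m3 s).
Proof.
move=> Q0 h0 h1 h2; have Qm x y : Q x -> Q y -> Q (maxn x y) by rewrite /maxn; case: ifP.
rewrite /tri_reg; apply: (Qm); first apply: (Qm).
- do 3![apply: big_maxn_ind => // ? _ *]; apply: h0; exact/eqP.
- apply: big_maxn_ind => // -[//|a] _ _; do 2![apply: big_maxn_ind => // ? _ *].
  by apply: h1; apply/eqP.
- apply: big_maxn_ind => // -[|[|a]] // _ _; do 2![apply: big_maxn_ind => // ? _ *].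
  by apply: h2; apply/eqP.
Qed.

Lemma tri_reg_ge0 m1 m2 m3 s a b c : (a + b + c)%N = s ->
  (tri_alpha m1 m2 m3 s a b c <= tri_reg m1 m2 m3 s)%N.
Proof.
move=> e; rewrite /tri_reg !leq_max -orbA; apply/orP; left.
apply: leq_trans (leq_big_maxn (i := a) _ _ _); [|lia|by []].
apply: leq_trans (leq_big_maxn (i := b) _ _ _); [|lia|by []].
by apply: leq_trans (leq_big_maxn (i := c) _ _ _); [|lia|apply/eqP].
Qed.

Lemma tri_reg_ge1 m1 m2 m3 s a b c : (a.+1 + b + c)%N = s ->
  (tri_alpha m1 m2 m3 s a.+1 b c + m3 - 1 <= tri_reg m1 m2 m3 s)%N.
Proof.
move=> e; rewrite /tri_reg !leq_max; apply/orP; left; apply/orP; right.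
apply: leq_trans (leq_big_maxn (i := a.+1) _ _ _); [|lia|by []].
apply: leq_trans (leq_big_maxn (i := b) _ _ _); [|lia|by []].
by apply: leq_trans (leq_big_maxn (i := c) _ _ _); [|lia|apply/eqP].
Qed.

Lemma tri_reg_ge2 m1 m2 m3 s a b c : (a.+2 + b + c)%N = s ->
  (tri_alpha m1 m2 m3 s a.+2 b c + 2 * m3 - 2 <= tri_reg m1 m2 m3 s)%N.
Proof.
move=> e; rewrite /tri_reg !leq_max; apply/orP; right.
apply: leq_trans (leq_big_maxn (i := a.+2) _ _ _); [|lia|by []].
apply: leq_trans (leq_big_maxn (i := b) _ _ _); [|lia|by []].
by apply: leq_trans (leq_big_maxn (i := c) _ _ _); [|lia|apply/eqP].
Qed.

Theorem theorem4p5 (K : fieldType) (m1 m2 m3 : nat)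
    (hm1 : (1 <= m1)%N) (hm2 : (1 <= m2)%N) (hm3 : (1 <= m3)%N)
    (s : nat) (hs : (2 <= s)%N) :
  let J := cover_ideal K (complete_tripartite m1 m2 m3) in
  let Js := ideal_pow J s in
  ((exists F : free_seq K (m1 + m2 + m3),
      minimal_graded_free_resolution unit_ideal Js F) /\
   (forall F : free_seq K (m1 + m2 + m3),
      minimal_graded_free_resolution unit_ideal Js F ->
      [/\ rk F 0 = 1%N,
          rk F 1 = 'C(s + 2, 2),
          rk F 2 = (2 * 'C(s + 1, 2))%N,
          rk F 3 = 'C(s, 2)
        & forall i : nat, (4 <= i)%N -> rk F i = 0%N])) /\
  is_reg Js zero_ideal (tri_reg m1 m2 m3 s)%:Z.
Proof.
case: s hs => // t ht J Js.
pose mx := mset (@part m1 m2 m3 0); pose my := mset (@part m1 m2 m3 1).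
pose mz := mset (@part m1 m2 m3 2).
have dx : mdeg mx = m1 by rewrite mdeg_mset card_part /= muln1 !muln0 !addn0.
have dy : mdeg my = m2 by rewrite mdeg_mset card_part /= muln1 !muln0 addn0.
have dz : mdeg mz = m3 by rewrite mdeg_mset card_part /= muln1 !muln0.
have x0 : mx != 0%MM by rewrite -mdeg_eq0 dx -lt0n.
have y0 : my != 0%MM by rewrite -mdeg_eq0 dy -lt0n.
have z0 : mz != 0%MM by rewrite -mdeg_eq0 dz -lt0n.
have hxy : mdisjoint my mx by apply/mset_disjoint/disjoint_part.
have hxz : mdisjoint mz mx by apply/mset_disjoint/disjoint_part.
have hyz : mdisjoint mz my by apply/mset_disjoint/disjoint_part.
have rT : resolves Js zero_ideal (tri_aug K mx my mz t).
  have := tri_seq_resolves K hxy hxz hyz t.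
  case=> g hA h0 h; split=> // f; rewrite -hA; apply: ideal_pow_tri_gen; exact: cover_idealE.
have mT : minimal_graded_free_resolution Js zero_ideal (tri_seq K mx my mz t).
  by split; [exists (tri_aug K mx my mz t) | exact: tri_seq_minimal].
have mC : minimal_graded_free_resolution unit_ideal Js (cone_seq (tri_aug K mx my mz t)).
  split; first exact: cone_resolution.
  by case=> [|i] p q; [exact: tri_aug_mcoeff0 | exact: tri_seq_minimal].
have hJs : homog_ideal Js := resolves_homog rT.
split; first split.
- by eexists; exact: mC.
- move=> F mF; have e i := minimal_rk hJs i mF mC.
  split; rewrite ?e //= ?card_triE ?addn2 ?addn1 ?mul2n ?addnn //.
  by case=> [|[|[|[|i]]]] // _; rewrite e.
have hZ := zero_ideal_homog K (m1 + m2 + m3).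
have deg0 a b : (a + b <= t.+1)%N -> tri_deg mx my mz t 0 a b =
    (tri_alpha m1 m2 m3 t.+1 a b (t.+1 - a - b))%:Z.
  by rewrite /tri_deg /tri_alpha dx dy dz; nia.
(* Passing to l1 = a + 1 takes one m3 out of alpha, which is added back; the truncated subtraction
   is exact since m3 >= 1. *)
have deg1 a b : (a + b < t.+1)%N -> tri_deg mx my mz t 1 a b - 1 =
    (tri_alpha m1 m2 m3 t.+1 a.+1 b (t.+1 - a.+1 - b) + m3 - 1)%N%:Z.
  by rewrite /tri_deg /tri_alpha dx dy dz; nia.
have deg2 a b : (a + b < t)%N -> tri_deg mx my mz t 2 a b - 2 =
    (tri_alpha m1 m2 m3 t.+1 a.+2 b (t.+1 - a.+2 - b) + 2 * m3 - 2)%N%:Z.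
  by rewrite /tri_deg /tri_alpha dx dy dz; nia.
have bound i j : Tor_neq0 Js zero_ideal i j -> j - i%:Z <= (tri_reg m1 m2 m3 t.+1)%:Z.
  move=> /(Tor_neq0_gdeg hZ mT.1) [p <-].
  case: i p => [|[|[|i]]] /= p; last by case: p.
  - have := tri_lt p => h; rewrite subr0 deg0 // lez_nat; apply: tri_reg_ge0; lia.
  - case: split => u; have := tri_lt u => h; rewrite deg1 // lez_nat; apply: tri_reg_ge1; lia.
  - have := tri_lt p => h; rewrite deg2 // lez_nat; apply: tri_reg_ge2; lia.
split=> //; pose Q k := exists i j, Tor_neq0 Js zero_ideal i j /\ j - i%:Z = k%:Z.
have Q0 a b c : (a + b + c)%N = t.+1 -> Q (tri_alpha m1 m2 m3 t.+1 a b c).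
  move=> e; have [|u [ea eb]] := @tri_idx t.+2 a b; first by lia.
  exists 0%N, (tri_deg mx my mz t 0 a b); split.
    have := @gdeg_Tor_neq0 _ _ _ _ (tri_seq K mx my mz t) 0 u mT.
    by rewrite /= ea eb.
  by rewrite subr0 deg0; [have -> : c = (t.+1 - a - b)%N | ]; lia.
(* The value 0 from empty maxima is harmless: if the maximum is 0, so is its entry at (0, 0, s),
   which is attained by [Q0]. *)
suff [h|//] : tri_reg m1 m2 m3 t.+1 = 0 \/ Q (tri_reg m1 m2 m3 t.+1).
  have := @Q0 0 0 t.+1 erefl; have := @tri_reg_ge0 m1 m2 m3 t.+1 0 0 t.+1 erefl.
  by rewrite h leqn0 => /eqP ->.
apply: (@tri_reg_ind (fun k => k = 0 \/ Q k)) => [|a b c e|a b c e|a b c e]; first by left.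
- by right; apply: Q0.
- right; have [|u [ea eb]] := @tri_idx t.+1 a b; first by lia.
  exists 1%N, (tri_deg mx my mz t 1 a b); split.
    (* The two copies in F_1 have the same degrees; the left one serves as witness. *)
    have := @gdeg_Tor_neq0 _ _ _ _ (tri_seq K mx my mz t) 1 (lshift _ u) mT.
    by rewrite /= (unsplitK (inl u)) ea eb.
  by rewrite deg1; [have -> : c = (t.+1 - a.+1 - b)%N | ]; lia.
- right; have [|u [ea eb]] := @tri_idx t a b; first by lia.
  exists 2%N, (tri_deg mx my mz t 2 a b); split.
    have := @gdeg_Tor_neq0 _ _ _ _ (tri_seq K mx my mz t) 2 u mT.
    by rewrite /= ea eb.
  by rewrite deg2; [have -> : c = (t.+1 - a.+2 - b)%N | ]; lia.
Qed.
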